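(* Let $\gamma\in\,]0,1[$ be such that $\gamma^{-1}\notin\mathbb N$, and let $N=\lfloor\gamma^{-1}\rfloor$. There is a transitive free action of the additive group $\mathcal C^\gamma$ on the set $\mathbf{BRP}^\gamma$ of branched $\gamma$-rough paths, namely a map $\mathcal C^\gamma\times\mathbf{BRP}^\gamma\to\mathbf{BRP}^\gamma$, $(g,X)\mapsto gX$, such that: (1) for all $g,g'\in\mathcal C^\gamma$ and $X\in\mathbf{BRP}^\gamma$ one has $g'(gX)=(g+g')X$; (2) if $g=(g^\tau)_{\tau\in\mathcal T_N}\in\mathcal C^\gamma$ is such that there exists a unique $\tau\in\mathcal T_N$ with $g^\tau\not\equiv0$, then for this $\tau$ and every $X\in\mathbf{BRP}^\gamma$ $$\langle (gX)_{st},\tau\rangle=\langle X_{st},\tau\rangle+g^\tau_t-g^\tau_s,\qquad s,t\in[0,1],$$ and $\langle gX,\sigma\rangle=\langle X,\sigma\rangle$ for all $\sigma\in\mathcal T$ not containing $\tau$; (3) for every pair $X,X'\in\mathbf{BRP}^\gamma$ there exists a unique $g\in\mathcal C^\gamma$ such that $gX=X'$.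
   Context: Fix $d\ge1$. $\mathcal T$ is the set of non-empty non-planar rooted trees with nodes decorated by $\{1,\dots,d\}$; $\mathcal F$ is the set of forests (finite multisets of elements of $\mathcal T$, including the empty forest $\mathbf 1$); $|\tau|$ is the number of nodes of $\tau$; $\mathcal T_n=\{\tau\in\mathcal T:|\tau|\le n\}$. $\mathcal H$ is the real vector space spanned by $\mathcal F$, with commutative product given by disjoint union of forests (unit $\mathbf 1$), and with the Butcher--Connes--Kreimer coproduct: the unique algebra morphism $\Delta:\mathcal H\to\mathcal H\otimes\mathcal H$ with $\Delta[\tau]_i=[\tau]_i\otimes\mathbf 1+(\mathrm{id}\otimes[\cdot]_i)\Delta\tau$, where for a forest $\tau=\tau_1\cdots\tau_k$, $[\tau]_i$ denotes the tree obtained by grafting $\tau_1,\dots,\tau_k$ onto a new root decorated by $i$. $G$ is the set of characters of $\mathcal H$, i.e. nonzero linear maps $X:\mathcal H\to\mathbb R$ with $\langle X,\tau\sigma\rangle=\langle X,\tau\rangle\langle X,\sigma\rangle$; it is a group under $\langle X\star Y,\tau\rangle=\langle X\otimes Y,\Delta\tau\rangle$. A branched $\gamma$-rough path is a map $X:[0,1]^2\to G$ such that $X_{su}\star X_{ut}=X_{st}$ for all $s,u,t\in[0,1]$ and, for every $\tau\in\mathcal F$, there is a constant $C_\tau$ with $|\langle X_{st},\tau\rangle|\le C_\tau|t-s|^{\gamma|\tau|}$ for all $s,t\in[0,1]$. $\mathbf{BRP}^\gamma$ is the set of all of them. For $\beta\in\,]0,1[$, $C^\beta([0,1])$ is the space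 of real $\beta$-Hölder functions on $[0,1]$. $\mathcal C^\gamma$ is the set of families $(g^\tau)_{\tau\in\mathcal T_N}$ with $g^\tau\in C^{\gamma|\tau|}([0,1])$ and $g^\tau_0=0$, an abelian group under pointwise addition. A tree $\sigma\in\mathcal T$ contains $\tau\in\mathcal T$ if there is a subtree (connected subgraph) $\tau'$ of $\sigma$, not necessarily containing the root of $\sigma$, such that $\tau$ and $\tau'$ are isomorphic as decorated rooted trees, the root of $\tau'$ being its node closest to the root of $\sigma$. *)

(* Defs.v *)
From HB Require Import structures.
From mathcomp Require Import all_boot all_order all_algebra.
From mathcomp Require Import generic_quotient finmap.
From mathcomp Require Import monalg.
From mathcomp Require Import boolp classical_sets functions reals exp.

Set Implicit Arguments.
Unset Strict Implicit.
Unset Printing Implicit Defensive.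

Import Order.TTheory GRing.Theory Num.Theory.

Local Open Scope ring_scope.
Local Open Scope quotient_scope.

(** Planar decorated rooted trees; the decorations 1, ..., d are encoded as
    the elements 0, ..., d-1 of 'I_d. *)

Inductive ptree (d : nat) : Type := PNode of 'I_d & seq (ptree d).

Section PlanarTrees.
Variable d : nat.
Implicit Types t u : ptree d.

Definition ptree_nested_ind (P : ptree d -> Prop)
  (H : forall i s, foldr (fun t Q => P t /\ Q) True s -> P (PNode i s)) :=
  fix F t : P t :=
    let: PNode i s := t in
    H i s ((fix G s : foldr (fun t Q => P t /\ Q) True s :=
      if s is t' :: s' then conj (F t') (G s') else I) s).

Fixpoint ptree_encode t : GenTree.tree 'I_d :=
  let: PNode i s := t in
  GenTree.Node 0 (GenTree.Leaf i :: [seq ptree_encode u | u <- s]).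

Fixpoint ptree_decode (c : GenTree.tree 'I_d) : option (ptree d) :=
  match c with
  | GenTree.Node _ (GenTree.Leaf i :: cs) =>
      Some (PNode i (pmap ptree_decode cs))
  | _ => None
  end.

Lemma ptree_encodeK : pcancel ptree_encode ptree_decode.
Proof.
elim/ptree_nested_ind=> i s IH /=; congr (Some (PNode i _)).
by elim: s IH => //= t s IHs [-> /IHs ->].
Qed.

HB.instance Definition _ := Countable.copy (ptree d) (pcan_type ptree_encodeK).

Lemma ptree_ind_mem (P : ptree d -> Prop) :
  (forall i s, {in s, forall t, P t} -> P (PNode i s)) -> forall t, P t.
Proof.
move=> H; elim/ptree_nested_ind=> i s IH; apply: H.
elim: s IH => //= t s IHs [Pt /IHs Ps] u.
by rewrite inE => /predU1P[->|/Ps].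
Qed.

Fixpoint psize t : nat := let: PNode _ s := t in (sumn (map psize s)).+1.

(** Isomorphism of decorated rooted trees: equal root decorations, and the
    branches at the two roots are pairwise isomorphic in some order. *)
Fixpoint piso t u {struct t} : bool :=
  let: PNode i s := t in
  let: PNode j v := u in
  (i == j) && has (all2 piso s) (permutations v).

(** All ways to discard some of the lists of [ls] and to pick an element in each
    of the other ones. *)
Definition choices (T : Type) (ls : seq (seq T)) : seq (seq T) :=
  foldr (fun l acc => acc ++ [seq x :: v | x <- l, v <- acc]) [:: [::]] ls.

(** [rsubtrees t] lists the connected subgraphs of [t] that contain the root of
    [t]: every edge at the root is either cut, or kept together with a connected
    subgraph containing its lower end.  [subtrees t] lists all the non-empty
    connected subgraphs of [t], each one being rooted at its node closest to the
    root of [t], which is either the root of [t] or in a branch of [t]. *)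
Fixpoint rsubtrees t : seq (ptree d) :=
  let: PNode i s := t in
  [seq PNode i v | v <- choices [seq rsubtrees u | u <- s]].

Fixpoint subtrees t : seq (ptree d) :=
  rsubtrees t ++ (let: PNode _ s := t in flatten [seq subtrees u | u <- s]).

End PlanarTrees.

Section All2Perm.
Variables (A : eqType) (B : eqType).
Implicit Types (r : A -> B -> bool) (s : seq A) (t : seq B).

Lemma all2_map_iota (x0 : A) (y0 : B) r s t :
  all2 r s t =
  (size s == size t) && all (fun i => r (nth x0 s i) (nth y0 t i)) (iota 0 (size s)).
Proof.
elim: s t => [|x s IH] [|y t] //=; rewrite IH eqSS andbCA; congr (_ && (_ && _)).
by rewrite (iotaDl 1 0) all_map.
Qed.

Lemma all2_perm r s t t' : all2 r s t -> perm_eq t t' ->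
  exists2 s', perm_eq s s' & all2 r s' t'.
Proof.
case: s t => [|x0 s] [|y0 t] //.
  by move=> _ /perm_size/esym/size0nil ->; exists [::].
set s1 := x0 :: s; set t1 := y0 :: t => st.
rewrite perm_sym => /(perm_iotaP y0)[Is pI ->].
move: st; rewrite (all2_map_iota x0 y0) => /andP[/eqP sz /allP st].
exists [seq nth x0 s1 i | i <- Is].
  by rewrite perm_sym; apply/(perm_iotaP x0); exists Is; rewrite // sz.
have {}st i : i \in Is -> r (nth x0 s1 i) (nth y0 t1 i).
  by rewrite (perm_mem pI) -sz; apply: st.
elim: (Is) st => //= i l IH st; rewrite st ?mem_head //= IH // => j jl.
by rewrite st // inE jl orbT.
Qed.

End All2Perm.

Section Isomorphism.
Variable d : nat.
Implicit Types t u : ptree d.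

Lemma pisoP (i j : 'I_d) s v :
  reflect (i = j /\ exists2 w, perm_eq w v & all2 (@piso d) s w)
          (piso (PNode i s) (PNode j v)).
Proof.
apply: (iffP andP) => [[/eqP -> /hasP[w wv sw]]|[-> [w wv sw]]]; split => //.
  by rewrite mem_permutations in wv; exists w.
by apply/hasP; exists w; rewrite ?mem_permutations.
Qed.

Lemma piso_refl : reflexive (@piso d).
Proof.
elim/ptree_ind_mem=> i s IH; apply/pisoP; split=> //; exists s => //.
elim: s IH => //= t s IHs IH; rewrite IH ?mem_head //= IHs // => u us.
by apply: IH; rewrite inE us orbT.
Qed.

Lemma piso_trans : transitive (@piso d).
Proof.
move=> u t; elim/ptree_ind_mem: t u => i s IH [j v] [k w].
move=> /pisoP[-> [v' vv' sv']] /pisoP[-> [w' ww' vw']].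
rewrite perm_sym in vv'.
have [x /esym w'x v'x] : exists2 x, perm_eq w' x = true & all2 (@piso d) v' x.
  have vw'' : all2 (fun a b => piso b a) w' v.
    by elim: v w' vw' {vv' ww'} => [|a v IHv] [|b w'] //= /andP[-> /IHv].
  have [x wx xv] := all2_perm vw'' vv'.
  exists x => //; elim: v' x xv {sv' wx vv'} => [|a v' IHv] [|b x] //=.
  by move=> /andP[-> /IHv].
apply/pisoP; split=> //; exists x.
  by apply: perm_trans ww'; rewrite perm_sym -w'x.
elim: s v' x IH sv' v'x {vv' w'x} => [|a s IHs] [|b v'] [|c x] //= IH.
move=> /andP[ab sv] /andP[bc vx]; rewrite (IH a (mem_head _ _) b) //=.
by apply: IHs sv vx => y ys; apply: IH; rewrite inE ys orbT.
Qed.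

Lemma piso_sym : symmetric (@piso d).
Proof.
suff H t u : piso t u -> piso u t by move=> t u; apply/idP/idP; apply: H.
elim/ptree_ind_mem: t u => i s IH [j v] /pisoP[-> [w wv sw]].
have [s' ss' s'v] := all2_perm sw wv.
apply/pisoP; split=> //; exists s'; first by rewrite perm_sym.
have {IH} : {in s', forall t u, piso t u -> piso u t}.
  by move=> x; rewrite -(perm_mem ss'); apply: IH.
elim: s' v s'v {wv ss'} => [|a s' IHs] [|b v] //= /andP[ab sv] IH.
rewrite (IH a (mem_head _ _)) //=; apply: IHs sv _ => y ys.
by apply: IH; rewrite inE ys orbT.
Qed.

Canonical piso_equiv := EquivRel (@piso d) piso_refl piso_sym piso_trans.

Lemma choices_catP (A : eqType) (l1 l2 : seq (seq A)) v :
  reflect (exists v1 v2, [/\ v = v1 ++ v2, v1 \in choices l1 & v2 \in choices l2])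
          (v \in choices (l1 ++ l2)).
Proof.
elim: l1 v => [|l l1 IH] v /=.
  apply: (iffP idP) => [vl|[v1 [v2 [-> + v2l]]]].
    by exists [::], v; rewrite inE.
  by rewrite inE => /eqP ->.
rewrite mem_cat; apply: (iffP orP).
  case=> [/IH[v1 [v2 [-> v1l v2l]]]|].
    by exists v1, v2; rewrite mem_cat v1l.
  case/allpairsP => -[a w] [/= al /IH[v1 [v2 [-> v1l v2l]]] ->].
  exists (a :: v1), v2; split=> //; rewrite mem_cat; apply/orP; right.
  by apply/allpairsP; exists (a, v1).
case=> v1 [v2 [-> + v2l]]; rewrite mem_cat => /orP[v1l|].
  by left; apply/IH; exists v1, v2.
case/allpairsP => -[a w] [/= al wl ->]; right.
by apply/allpairsP; exists (a, w ++ v2); split=> //=; apply/IH; exists w, v2.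
Qed.

Lemma choices_perm (A : eqType) (l1 l2 : seq (seq A)) v :
  perm_eq l1 l2 -> v \in choices l1 ->
  exists2 w, perm_eq v w & w \in choices l2.
Proof.
move=> l12 vl; pose P l := exists2 w, perm_eq v w & w \in choices l.
apply: (@catCA_perm_ind _ P) l12 _; last by exists v.
move=> s1 s2 s3 [w vw /choices_catP[w1 [w' [E w1s /choices_catP[w2 [w3 [E' w2s w3s]]]]]]].
exists (w2 ++ w1 ++ w3); first by rewrite (perm_trans vw) // E E' perm_catCA.
apply/choices_catP; exists w2, (w1 ++ w3); split=> //.
by apply/choices_catP; exists w1, w3.
Qed.

Lemma choices_piso s v :
  {in s, forall t u, piso t u -> forall a, a \in rsubtrees t ->
     exists2 b, piso a b & b \in rsubtrees u} ->
  all2 (@piso d) s v -> forall x, x \in choices [seq rsubtrees u | u <- s] ->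
  exists2 y, all2 (@piso d) x y & y \in choices [seq rsubtrees u | u <- v].
Proof.
elim: s v => [|t s IH] [|u v] //= H.
  by move=> _ x; rewrite inE => /eqP ->; exists [::].
case/andP=> tu sv x.
have {}IH := IH v (fun y ys => H y (mem_behead (s := t :: s) ys)) sv.
rewrite mem_cat => /orP[/IH[y xy yv]|].
  by exists y; rewrite // mem_cat yv.
case/allpairsP => -[a w] [/= ta /IH[y wy yv] ->].
have [b ab bu] := H t (mem_head _ _) u tu a ta.
exists (b :: y); first by rewrite /= ab.
by rewrite mem_cat; apply/orP; right; apply/allpairsP; exists (b, y).
Qed.

Lemma rsubtrees_piso t u a : piso t u -> a \in rsubtrees t ->
  exists2 b, piso a b & b \in rsubtrees u.
Proof.
elim/ptree_ind_mem: t u a => i s IH [j v] a /pisoP[<- [w wv sw]] /=.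
case/mapP => x xs ->.
have {}IH : {in s, forall t u, piso t u -> forall a, a \in rsubtrees t ->
    exists2 b, piso a b & b \in rsubtrees u}.
  by move=> t ts u tu b; apply: IH.
have [y xy yw] := choices_piso IH sw xs.
have [z yz zv] := choices_perm (perm_map (@rsubtrees d) wv) yw.
exists (PNode i z); last exact: map_f.
by apply/pisoP; split=> //; exists y.
Qed.

Lemma subtrees_piso t u a : piso t u -> a \in subtrees t ->
  exists2 b, piso a b & b \in subtrees u.
Proof.
elim/ptree_ind_mem: t u a => i s IH [j v] a tu.
have -> k r : subtrees (PNode k r) =
  rsubtrees (PNode k r) ++ flatten [seq subtrees x | x <- r] :> seq (ptree d) by [].
rewrite mem_cat => /orP[/(rsubtrees_piso tu)[b ab bu]|].
  by exists b; rewrite // mem_cat bu.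
case/flatten_mapP => x xs ax; move: tu => /pisoP[_ [w wv sw]].
have [y yv xy] : exists2 y, y \in v & piso x y.
  suff: exists2 y, y \in w & piso x y by case=> y; rewrite (perm_mem wv); exists y.
  elim: s w sw xs {IH wv} => [|c s IHs] [|e w] //= /andP[ce sw].
  rewrite inE => /predU1P[->|/(IHs w sw)[y yw xy]].
    by exists e; rewrite ?mem_head.
  by exists y; rewrite // inE yw orbT.
have [b ab bx] := IH x xs y a xy ax; exists b => //.
by rewrite mem_cat; apply/orP; right; apply/flatten_mapP; exists y.
Qed.

(** Non-planar decorated rooted trees. *)
Definition tree := {eq_quot (@piso d)}.

HB.instance Definition _ := Choice.on tree.
HB.instance Definition _ := EqQuotient.on tree.

Definition tsize (tau : tree) : nat := psize (repr tau).

(** [contains sigma tau]: some connected subgraph of [sigma] is isomorphic to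
    [tau]. *)
Definition contains (sigma tau : tree) : bool :=
  tau \in [seq \pi_tree u | u <- subtrees (repr sigma)].

Lemma contains_pi t (tau : tree) :
  contains (\pi_tree t) tau = (tau \in [seq \pi_tree u | u <- subtrees t]).
Proof.
suff H u v : piso u v -> tau \in [seq \pi_tree x | x <- subtrees u] ->
    tau \in [seq \pi_tree x | x <- subtrees v].
  have tr : piso t (repr (\pi_tree t)) by rewrite -eqmodE reprK.
  by apply/idP/idP; apply: H; rewrite // piso_sym.
move=> uv /mapP[a au ->]; have [b ab bv] := subtrees_piso uv au.
by apply/mapP; exists b => //; apply/eqP; rewrite eqmodE.
Qed.

(** Forests, i.e. finite multisets of trees, with disjoint union as product. *)
Local Notation forest := {cmonom tree}.

Definition forest_seq (f : forest) : seq tree :=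
  flatten [seq nseq (f tau) tau | tau <- finsupp f].

Definition fsize (f : forest) : nat := sumn (map tsize (forest_seq f)).

(** The tree obtained by grafting the trees of [f] on a new root. *)
Definition graft (i : 'I_d) (f : forest) : tree :=
  \pi_tree (PNode i [seq repr tau | tau <- forest_seq f]).

Implicit Types (f g : forest) (tau rho : tree).

Lemma count_forest_seq f tau : count_mem tau (forest_seq f) = f tau.
Proof.
rewrite /forest_seq count_flatten -map_comp sumnE big_map.
rewrite (eq_bigr (fun rho => (rho == tau) * f rho)%N); last first.
  by move=> rho _; rewrite /= count_nseq.
case: (finsuppP f tau) => tauf.
  rewrite big1_seq // => rho /= rhof; case: eqP tauf => // <-.
  by rewrite rhof.
rewrite (big_fsetD1 tau) //= eqxx mul1n big1_fset ?addn0 // => rho.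
by rewrite !inE => /andP[/negPf ->].
Qed.

Lemma forest_seqP f s :
  (forall tau, count_mem tau s = f tau) -> perm_eq (forest_seq f) s.
Proof.
by move=> H; apply/allP => tau _; rewrite /= count_forest_seq H.
Qed.

Lemma forest_seq1 : forest_seq mone = [::].
Proof.
by apply: perm_nilP; rewrite forest_seqP // => tau; rewrite cm1.
Qed.

Lemma forest_seqU tau : forest_seq (ucm tau) = [:: tau].
Proof.
by apply: perm_small_eq; rewrite // forest_seqP //= => rho; rewrite cmU addn0.
Qed.

Lemma forest_seqM f g :
  perm_eq (forest_seq (mmul f g)) (forest_seq f ++ forest_seq g).
Proof.
by apply: forest_seqP => tau; rewrite count_cat !count_forest_seq cmM.
Qed.

Definition seq_forest (s : seq tree) : forest :=
  \big[mmul/mone]_(tau <- s) ucm tau.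

Lemma seq_forestE s tau : seq_forest s tau = count_mem tau s.
Proof.
elim: s => [|rho s IH]; rewrite /seq_forest ?big_nil ?cm1 //.
by rewrite big_cons cmM cmU -/(seq_forest s) IH.
Qed.

Lemma forest_seqK : cancel forest_seq seq_forest.
Proof.
by move=> f; apply/eqP/cmP => tau; rewrite seq_forestE count_forest_seq.
Qed.

Lemma perm_forest_seq s : perm_eq (forest_seq (seq_forest s)) s.
Proof. by apply: forest_seqP => tau; rewrite seq_forestE. Qed.

Lemma graftE i s :
  graft i (seq_forest [seq \pi_tree t | t <- s]) = \pi_tree (PNode i s).
Proof.
apply/eqP; rewrite eqmodE; apply/pisoP; split=> //.
set w := forest_seq _; have wp : perm_eq w [seq \pi_tree t | t <- s].
  exact: perm_forest_seq.
have H : all2 (fun t x => piso (repr x) t) s [seq \pi_tree t | t <- s].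
  by elim: s {w wp} => //= t s ->; rewrite andbT -eqmodE reprK.
rewrite perm_sym in wp; have [v sv vw] := all2_perm H wp.
exists v; first by rewrite perm_sym.
by elim: v w vw {sv wp} => [|t v IHv] [|x w] //= /andP[-> /IHv].
Qed.

Lemma graft_surj tau : exists i f, tau = graft i f.
Proof.
elim/quotW: tau => -[i s]; exists i, (seq_forest [seq \pi_tree t | t <- s]).
by rewrite graftE.
Qed.

Lemma psize_piso t u : piso t u -> psize t = psize u.
Proof.
elim/ptree_ind_mem: t u => i s IH [j v] /pisoP[_ [w wv sw]] /=; congr _.+1.
have -> : sumn (map (@psize d) v) = sumn (map (@psize d) w).
  by apply/perm_sumn/perm_map; rewrite perm_sym.
elim: s w IH sw {wv} => [|a s IHs] [|b w] //= IH /andP[ab sw].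
rewrite (IH a (mem_head _ _) b ab) (IHs w) // => x xs.
by apply: IH; rewrite inE xs orbT.
Qed.

Lemma tsize_pi t : tsize (\pi_tree t) = psize t.
Proof. by apply: psize_piso; rewrite -eqmodE reprK. Qed.

Lemma tsize_graft i f : tsize (graft i f) = (fsize f).+1.
Proof. by rewrite tsize_pi /= -map_comp. Qed.

Lemma fsizeM f g : fsize (mmul f g) = (fsize f + fsize g)%N.
Proof.
rewrite /fsize -sumn_cat -map_cat; apply/perm_sumn/perm_map.
exact: forest_seqM.
Qed.

Lemma fsizeU tau : fsize (ucm tau) = tsize tau.
Proof. by rewrite /fsize forest_seqU /= addn0. Qed.

End Isomorphism.

(** Pairs of forests, the canonical basis of H (x) H. *)
Section ProdMonomials.
Variables M1 M2 : conomType.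

Definition mul_pair (x y : M1 * M2) : M1 * M2 := (mmul x.1 y.1, mmul x.2 y.2).

Fact mul_pairA : associative mul_pair.
Proof. by move=> x y z; rewrite /mul_pair !mulmA. Qed.

Fact mul_pair1m : left_id (mone, mone) mul_pair.
Proof. by case=> x y; rewrite /mul_pair !mul1m. Qed.

Fact mul_pairm1 : right_id (mone, mone) mul_pair.
Proof. by case=> x y; rewrite /mul_pair !mulm1. Qed.

Fact mul_pairC : commutative mul_pair.
Proof. by move=> x y; rewrite /mul_pair mulmC [mmul x.2 _]mulmC. Qed.

Fact mul_pair_unit x y : mul_pair x y = (mone, mone) ->
  x = (mone, mone) /\ y = (mone, mone).
Proof.
by case: x y => [x1 x2] [y1 y2] [/unitm[/= -> ->] /unitm[/= -> ->]].
Qed.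

HB.instance Definition _ := Choice_isMonomialDef.Build (M1 * M2)%type
  mul_pairA mul_pair1m mul_pairm1 mul_pair_unit.
HB.instance Definition _ :=
  MonomialDef_isConomialDef.Build (M1 * M2)%type mul_pairC.
End ProdMonomials.

(** The element [k] of the canonical basis of the span of [K]; it is locked
    because comparing << k >> and << l >> by conversion does not terminate in
    practice when [k] and [l] differ. *)
HB.lock Definition mbasis (R : comNzRingType) (K : choiceType) (k : K) :
  {malg R[K]} := << k >>.

Arguments mbasis {R K} k.

Lemma mbasisE (R : comNzRingType) (K : choiceType) (k : K) :
  mbasis k = << k >> :> {malg R[K]}.
Proof. by rewrite mbasis.unlock. Qed.

Lemma mbasis1 (R : comNzRingType) (K : monomType) :
  mbasis mone = 1 :> {malg R[K]}.
Proof. exact: mbasisE. Qed.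

Lemma mbasisM (R : comNzRingType) (K : monomType) (k l : K) :
  mbasis (mmul k l) = mbasis k * mbasis l :> {malg R[K]}.
Proof. by rewrite !mbasisE malgM_def fgmulUU mulr1. Qed.

Lemma malg_sumE (R : comNzRingType) (K : choiceType) (z : {malg R[K]}) :
  z = \sum_(k <- msupp z) z@_k *: mbasis k.
Proof.
rewrite {1}(monalgE z); apply: eq_bigr => k _; apply/malgP => l.
by rewrite mbasisE mcoeffZ !mcoeffU mulr_natr.
Qed.

(** The linear extension to the span of [K] of a map defined on [K]. *)
Section LinearExtension.
Variables (R : comNzRingType) (K : choiceType) (M : lmodType R).
Variable h : K -> M.

Definition linext (z : {malg R[K]}) : M := \sum_(k <- msupp z) z@_k *: h k.

Lemma linextEw (D : {fset K}) z : (msupp z `<=` D)%fset ->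
  linext z = \sum_(k <- D) z@_k *: h k.
Proof.
move=> le; rewrite /linext (big_fset_incl _ le) //= => x _ /mcoeff_outdom ->.
by rewrite scale0r.
Qed.

Fact linext_is_linear : linear linext.
Proof.
move=> a x y; pose D := (msupp x `|` msupp y `|` msupp (a *: x + y))%fset.
have Dx : (msupp x `<=` D)%fset by rewrite /D -fsetUA fsubsetUl.
have Dy : (msupp y `<=` D)%fset by rewrite /D fsetUAC fsubsetUr.
rewrite (linextEw (fsubsetUr _ _ : msupp _ `<=` D)%fset).
rewrite (linextEw Dx) (linextEw Dy).
rewrite scaler_sumr -big_split /=; apply: eq_bigr => k _.
by rewrite mcoeffD mcoeffZ scalerDl scalerA.
Qed.

HB.instance Definition _ :=
  GRing.isLinear.Build R {malg R[K]} M *:%R linext linext_is_linear.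

Lemma linextU k : linext (mbasis k) = h k.
Proof.
by rewrite mbasisE (linextEw msuppU_le) big_seq_fset1 mcoeffUU scale1r.
Qed.
End LinearExtension.

Fact linext_is_multiplicative (R : comNzRingType) (K : monomType)
    (A : comAlgType R) (h : K -> A) :
  mmorphism h -> monoid_morphism (linext h).
Proof.
move=> hM; pose h' : {mmorphism K -> A} :=
  HB.pack h (isMultiplicative.Build K A h hM).
have E z : linext h z = mmap (in_alg A) h' z.
  by rewrite /mmap /linext; apply: eq_bigr => k _; rewrite mulr_algl.
by split=> [|x y]; rewrite !E ?rmorph1 ?rmorphM.
Qed.

Notation forest d := {cmonom (tree d)}.

Section HopfAlgebra.
Variables (R : comNzRingType) (d : nat).

(** The span of forests, with disjoint union as product. *)
Definition hopf := {malg R[forest d]}.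

(** H (x) H, as the span of pairs of forests. *)
Definition hopf2 := {malg R[(forest d * forest d)%type]}.

Definition of_forest (f : forest d) : hopf := mbasis f.
Definition of_tree (tau : tree d) : hopf := of_forest (ucm tau).
Definition of_pair (f g : forest d) : hopf2 := mbasis (f, g).

(** id (x) [.]_i *)
Definition id_graft (i : 'I_d) : hopf2 -> hopf2 :=
  linext (fun p : forest d * forest d => of_pair p.1 (ucm (graft i p.2))).

Fixpoint ptree_coproduct (t : ptree d) : hopf2 :=
  let: PNode i s := t in
  of_pair (ucm (\pi_(tree d) t)) mone +
  id_graft i (\prod_(z <- [seq ptree_coproduct u | u <- s]) z).

Definition forest_coproduct (f : forest d) : hopf2 :=
  \prod_(tau <- forest_seq f) ptree_coproduct (repr tau).

(** The Butcher-Connes-Kreimer coproduct, see [coproduct_graft] and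
    [coproduct_unique]. *)
Definition coproduct : hopf -> hopf2 := linext forest_coproduct.

HB.instance Definition _ i := GRing.Linear.on (id_graft i).
HB.instance Definition _ := GRing.Linear.on coproduct.

Fact forest_coproduct_mmorphism : mmorphism forest_coproduct.
Proof.
split=> [f g|]; rewrite /forest_coproduct ?forest_seq1 ?big_nil //.
by rewrite (perm_big _ (forest_seqM f g)) big_cat.
Qed.

HB.instance Definition _ :=
  GRing.isMonoidMorphism.Build hopf hopf2 coproduct
    (linext_is_multiplicative forest_coproduct_mmorphism).

Lemma ptree_coproduct_piso t u :
  piso t u -> ptree_coproduct t = ptree_coproduct u.
Proof.
elim/ptree_ind_mem: t u => i s IH [j v] tu; have := tu.
case/pisoP=> ij [w wv sw]; move: ij tu => <- tu /=.
have -> : \pi_(tree d) (PNode i s) = \pi_(tree d) (PNode i v).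
  by apply/eqP; rewrite eqmodE.
congr (_ + id_graft i _); rewrite !big_map -(perm_big _ wv) /=.
elim: s w sw IH {wv tu} => [|a s IHs] [|b w] //=.
move=> /andP[ab sw] IH; rewrite !big_cons (IH a (mem_head _ _) b ab).
by rewrite (IHs w) // => x xs; apply: IH; rewrite inE xs orbT.
Qed.

Lemma forest_coproductU (tau : tree d) :
  forest_coproduct (ucm tau) = ptree_coproduct (repr tau).
Proof. by rewrite /forest_coproduct forest_seqU big_seq1. Qed.

Lemma coproduct_forest f : coproduct (of_forest f) = forest_coproduct f.
Proof. exact: linextU. Qed.

Lemma coproduct_graft i f :
  coproduct (of_tree (graft i f)) =
  of_pair (ucm (graft i f)) mone + id_graft i (coproduct (of_forest f)).
Proof.
rewrite /of_tree !coproduct_forest forest_coproductU.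
have /ptree_coproduct_piso -> :
    piso (repr (graft i f)) (PNode i [seq repr tau | tau <- forest_seq f]).
  by rewrite -eqmodE reprK.
by rewrite /= !big_map.
Qed.

Lemma of_forest_seq (s : seq (tree d)) :
  of_forest (seq_forest s) = \prod_(tau <- s) of_tree tau.
Proof.
elim: s => [|tau s IH]; rewrite /seq_forest ?big_nil ?big_cons.
  exact: mbasis1.
by rewrite /of_forest mbasisM -/(seq_forest s) -IH.
Qed.

Lemma coproduct_unique (D : {lrmorphism hopf -> hopf2}) :
  (forall i f, D (of_tree (graft i f)) =
     of_pair (ucm (graft i f)) mone + id_graft i (D (of_forest f))) ->
  D =1 coproduct.
Proof.
move=> DE.
have Df (s : seq (tree d)) :
    {in s, forall tau, D (of_tree tau) = coproduct (of_tree tau)} ->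
    D (of_forest (seq_forest s)) = coproduct (of_forest (seq_forest s)).
  move=> H; rewrite of_forest_seq !rmorph_prod /=.
  by apply: eq_big_seq => tau /H.
have Dt t : D (of_tree (\pi_(tree d) t)) = coproduct (of_tree (\pi_(tree d) t)).
  elim/ptree_ind_mem: t => i s IH; rewrite -graftE DE coproduct_graft Df //.
  by move=> _ /mapP[t ts ->]; apply: IH.
move=> x; rewrite (malg_sumE x) !raddf_sum /=; apply: eq_bigr => f _.
rewrite !linearZ /= -(forest_seqK f) -/(of_forest _) Df // => tau _.
by elim/quotW: tau.
Qed.

End HopfAlgebra.

Section Characters.
Variables (R : realType) (d : nat).
Local Notation H := (hopf R d).

(** The elements of the group G. *)
Record character := Character {
  character_fun :> {scalar H};
  character_neq0 : exists x, character_fun x <> 0;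
  characterM : forall x y,
    character_fun (x * y) = character_fun x * character_fun y
}.

Lemma character1 (X : character) : X 1 = 1.
Proof.
have [x /eqP Xx] := character_neq0 X.
by apply: (mulfI Xx); rewrite -characterM !mulr1.
Qed.

Lemma character_inj (X Y : character) : X =1 Y -> X = Y.
Proof.
case: X Y => [X Xn XM] [Y Yn YM] /= XY.
suff E : X = Y.
  case: _ / E Yn YM {XY} => Yn YM.
  by congr Character; apply: Prop_irrelevance.
case: X Y XY {Xn XM Yn YM} => [f fc] [g gc] /= /funext fg.
case: _ / fg gc => gc; congr (GRing.Linear.Pack _).
case: fc gc => [[a] [b]] [[a'] [b']].
by rewrite (Prop_irrelevance a a') (Prop_irrelevance b b').
Qed.

(** <X (x) Y, z> *)
Definition tensor_form (X Y : character) : hopf2 R d -> R^o :=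
  linext (fun p : forest d * forest d =>
    X (of_forest R p.1) * Y (of_forest R p.2) : R^o).

HB.instance Definition _ X Y := GRing.Linear.on (tensor_form X Y).

Fact tensor_form_multiplicative X Y : monoid_morphism (tensor_form X Y).
Proof.
apply: linext_is_multiplicative; split=> [p q|] /=.
  by rewrite /of_forest !mbasisM !characterM mulrACA.
by rewrite /of_forest mbasis1 !character1 mulr1.
Qed.

Definition star_fun (X Y : character) (x : H) : R :=
  tensor_form X Y (coproduct x).

Fact star_fun_is_linear X Y : linear_for *%R (star_fun X Y).
Proof. by move=> a x y; rewrite /star_fun !linearP. Qed.

HB.instance Definition _ X Y :=
  GRing.isLinear.Build R H R *%R (star_fun X Y) (star_fun_is_linear X Y).

Fact star_fun_neq0 X Y : exists x, star_fun X Y x <> 0.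
Proof.
exists 1; rewrite /star_fun rmorph1 (tensor_form_multiplicative X Y).1.
exact/eqP/oner_neq0.
Qed.

Fact star_funM X Y x y :
  star_fun X Y (x * y) = star_fun X Y x * star_fun X Y y.
Proof. by rewrite /star_fun rmorphM (tensor_form_multiplicative X Y).2. Qed.

(** The product of G. *)
Definition star (X Y : character) : character :=
  @Character (star_fun X Y : {scalar H}) (star_fun_neq0 X Y) (star_funM X Y).

End Characters.

Section RoughPaths.
Variable R : realType.

Definition unit_interval := {x : R | 0 <= x <= 1}.
Implicit Types (f : unit_interval -> R) (s t : unit_interval).

Fact unit_interval0_subproof : 0 <= (0 : R) <= 1.
Proof. by rewrite lexx ler01. Qed.

Definition unit_interval0 : unit_interval := exist _ 0 unit_interval0_subproof.

Definition holder (beta : R) f :=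
  exists C, forall s t, `|f t - f s| <= C * `|val t - val s| `^ beta.

Variables (d : nat) (gamma : R).

Record branched_rough_path := BranchedRoughPath {
  brp_fun :> unit_interval -> unit_interval -> character R d;
  brp_chen : forall s u t, star (brp_fun s u) (brp_fun u t) = brp_fun s t;
  brp_regular : forall tau : forest d, exists C, forall s t,
    `|brp_fun s t (of_forest R tau)| <=
      C * `|val t - val s| `^ (gamma * (fsize tau)%:R)
}.

Lemma brp_inj (X Y : branched_rough_path) : (forall s t, X s t = Y s t) -> X = Y.
Proof.
move=> XY; have {XY} : brp_fun X = brp_fun Y by do 2![apply: funext => ?].
case: X Y => [X Xc Xr] [Y Yc Yr] /= E; case: _ / E Yc Yr => Yc Yr.
by congr BranchedRoughPath; apply: Prop_irrelevance.
Qed.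

Definition trees_upto (n : nat) := {tau : tree d | (tsize tau <= n)%N}.

(** N = floor (1 / gamma) *)
Definition holder_depth : nat := Num.truncn gamma^-1.

Definition tree_family := trees_upto holder_depth -> unit_interval -> R.

Definition holder_family_pred : {pred tree_family} := fun g =>
  `[< forall tau, holder (gamma * (tsize (val tau))%:R) (g tau) /\
                  g tau unit_interval0 = 0 >].

Fact holder0 beta : holder beta (0 : unit_interval -> R).
Proof. by exists 0 => s t; rewrite subrr normr0 mul0r. Qed.

Fact holderB beta f g : holder beta f -> holder beta g -> holder beta (f - g).
Proof.
move=> [C fC] [D gD]; exists (C + D) => s t.
have -> : (f - g) t - (f - g) s = (f t - f s) - (g t - g s).
  rewrite [LHS](_ : _ = (f t - g t) - (f s - g s)) // !opprB.
  by rewrite [g s - f s]addrC addrACA [- g t + g s]addrC.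
by rewrite mulrDl (le_trans (ler_normB _ _)) // lerD.
Qed.

Fact holder_family_zmod_closed : zmod_closed holder_family_pred.
Proof.
split=> [|g h /asboolP gP /asboolP hP]; apply/asboolP => tau.
  by split; first exact: holder0.
have [[gH g0] [hH h0]] := (gP tau, hP tau); split; first exact: holderB.
have -> : (g - h) tau unit_interval0 = g tau unit_interval0 - h tau unit_interval0.
  by [].
by rewrite g0 h0 subr0.
Qed.

HB.instance Definition _ :=
  GRing.isZmodClosed.Build tree_family holder_family_pred holder_family_zmod_closed.

(** The abelian group of Hoelder families, under pointwise addition. *)
Record holder_family := HolderFamily {
  holder_family_val :> trees_upto holder_depth -> unit_interval -> R;
  _ : holder_family_val \in holder_family_pred
}.

HB.instance Definition _ := [isSub for holder_family_val].
HB.instance Definition _ := [Choice of holder_family by <:].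
HB.instance Definition _ := [SubChoice_isSubZmodule of holder_family by <:].

Lemma holder_familyD (g h : holder_family) tau t : (g + h) tau t = g tau t + h tau t.
Proof. by []. Qed.

End RoughPaths.

(* Main.v *)
(** The reduced coproduct of a tree [tau] only involves forests of trees that
    are contained in [tau] and have fewer nodes, so that Chen's relation at
    [tau] reads [F s t = F s u + F u t + H s u t], where [F s t] is
    [<X_st, tau>] and the cocycle [H] is determined by the values of [X] on
    smaller trees.  As [gamma * |tau|] is never equal to [1], a cocycle of
    Hoelder order [gamma * |tau|] has such a lift [F]: on dyadic points, it is
    built by Riemann sums if the order exceeds [1], and by adding midpoints
    level by level if it is less than [1], with bounds uniform in the level;
    an upper limit then gives [F].  Two lifts differ by the increments of a
    Hoelder function, which is constant if the order exceeds [1].  Fixing once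
    and for all a lift of every cocycle, the differences between [X] and these
    lifts are coordinates that identify the set of branched rough paths with
    the group of Hoelder families, and this group acts by translation of the
    coordinates. *)

Require Import Defs.
From HB Require Import structures.
From mathcomp Require Import all_boot all_order all_algebra.
From mathcomp Require Import generic_quotient finmap.
From mathcomp Require Import monalg.
From mathcomp Require Import boolp classical_sets functions reals exp.
From mathcomp Require Import ring lra zify.

Set Implicit Arguments.
Unset Strict Implicit.
Unset Printing Implicit Defensive.

Import Order.TTheory GRing.Theory Num.Theory.

Local Open Scope ring_scope.

(** * Sewing along the integers, at dyadic lengths *)

Section DiscreteSewing.
Variables (R : realType) (q : R).
Hypotheses (q_gt1 : 1 < q) (q_neq2 : q != 2).

Definition germ_defect (T : Type) (A : T -> T -> R) s u t : R := A s t - A s u - A u t.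

Definition lift_defect (T : Type) (A : T -> T -> R) (f : T -> R) s t : R :=
  f t - f s - A s t.

(** With [q] the a-th power of 2, [q ^+ m] is the a-th power of the length [2 ^ m]: a discrete form
    of a Hölder bound of order a on the defect. *)
Definition almost_additive (A : nat -> nat -> R) (K : R) :=
  forall m i k j, (i <= k <= j)%N -> (j - i <= 2 ^ m)%N ->
    `|germ_defect A i k j| <= K * q ^+ m.

(** Writing c for this constant, the passage from one level to the next closes up exactly:
    [2 * c + q = c * q] if [q > 2], and [c * q + q = 2 * c] if [q < 2]. *)
Definition dyadic_const : R := q / `|2 - q|.

Lemma dyadic_const_ge0 : 0 <= dyadic_const.
Proof. by rewrite divr_ge0 // ltW // (lt_trans ltr01). Qed.

Lemma lift_defectD (T : Type) (A : T -> T -> R) (f : T -> R) s u t :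
  lift_defect A f s t =
  lift_defect A f s u + lift_defect A f u t - germ_defect A s u t.
Proof. by rewrite /lift_defect /germ_defect; ring. Qed.

Let q_ge0 : 0 <= q. Proof. by rewrite ltW // (lt_trans ltr01). Qed.

(** Riemann sums have no defect on unit cells. A cell of the next level adds the defects of its two
    halves and one germ defect, and [2 * c + q = c * q] preserves the constant. *)
Lemma dyadic_lift_gt2 (A : nat -> nat -> R) K : 2 < q -> 0 <= K ->
  almost_additive A K -> exists f, forall m k,
    `|lift_defect A f (k * 2 ^ m)%N (k.+1 * 2 ^ m)%N| <= dyadic_const * K * q ^+ m.
Proof.
move=> q2 K0 AK; exists (fun k => \sum_(i < k) A i i.+1); elim=> [|m IH] k.
  rewrite expn0 !muln1 /lift_defect big_ord_recr /= addrAC addrK subrr normr0.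
  exact: mulr_ge0 (mulr_ge0 dyadic_const_ge0 K0) (exprn_ge0 _ q_ge0).
have -> : (k * 2 ^ m.+1 = k.*2 * 2 ^ m)%N by rewrite expnS mulnA muln2.
have -> : (k.+1 * 2 ^ m.+1 = k.*2.+2 * 2 ^ m)%N by rewrite expnS mulnA muln2.
rewrite (lift_defectD _ _ _ (k.*2.+1 * 2 ^ m)%N).
have D : `|germ_defect A (k.*2 * 2 ^ m)%N (k.*2.+1 * 2 ^ m)%N (k.*2.+2 * 2 ^ m)%N| <= K * q ^+ m.+1.
  by apply: AK; [apply/andP; split; apply: leq_mul | rewrite -mulnBl expnS leq_mul2r; lia].
have H1 := IH k.*2; have H2 := IH k.*2.+1.
apply: le_trans (ler_normB _ _) _; apply: le_trans (lerD (ler_normD _ _) (lexx _)) _.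
apply: le_trans (lerD (lerD H1 H2) D) _.
rewrite exprS; move: (q ^+ m) (exprn_ge0 m q_ge0) => x x0.
rewrite /dyadic_const ltr0_norm ?subr_lt0 //.
have -> : K * (q * x) = q / - (2 - q) * K * (q * x) - q / - (2 - q) * K * x *+ 2.
  by field; lra.
by rewrite mulr2n; lra.
Qed.

(* Each new odd point is placed so as to share the defect equally. *)
Lemma dyadic_lift_lt2 n (A : nat -> nat -> R) K : q < 2 -> 0 <= K ->
  almost_additive A K -> exists f, forall m k, (m <= n)%N ->
    `|lift_defect A f (k * 2 ^ m)%N (k.+1 * 2 ^ m)%N| <= dyadic_const * K * q ^+ m.
Proof.
move=> q2; elim: n A K => [|n IH] A K K0 AK.
  exists (fun k => \sum_(i < k) A i i.+1) => m k; rewrite leqn0 => /eqP ->.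
  rewrite expn0 !muln1 /lift_defect big_ord_recr /= addrAC addrK subrr normr0.
  exact: mulr_ge0 (mulr_ge0 dyadic_const_ge0 K0) (exprn_ge0 _ q_ge0).
(* The even points are lifted first: a unit step between them has length 2, which costs a factor [q]
   in the constant. *)
have [|m i k j ikj ji|f fP] := IH (fun i j => A i.*2 j.*2) (K * q).
- by rewrite mulr_ge0.
- rewrite -mulrA -exprS; apply: AK; first by rewrite !leq_double.
  by rewrite -doubleB expnS mul2n leq_double.
pose g j := if odd j then
  (f j./2 + A j.-1 j + f j./2.+1 - A j j.+1) / 2 else f j./2.
have gE i : g i.*2 = f i by rewrite /g odd_double doubleK.
have gO i : g i.*2.+1 = (f i + A i.*2 i.*2.+1 + f i.+1 - A i.*2.+1 i.*2.+2) / 2.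
  by rewrite /g /= odd_double /= uphalf_double.
(* Common value of the defects of [g] on the two halves of a cell, bounded thanks to
   [c * q + q = 2 * c]. *)
have sm i : (`|(lift_defect (fun i j => A i.*2 j.*2) f i i.+1 +
     germ_defect A i.*2 i.*2.+1 i.*2.+2) / 2| <= dyadic_const * K).
  have /= H := fP 0%N i isT; rewrite expn0 !muln1 expr0 mulr1 in H.
  have D : `|germ_defect A i.*2 i.*2.+1 i.*2.+2| <= K * q ^+ 1 by apply: AK; lia.
  rewrite normrM [ `|2^-1|]ger0_norm ?invr_ge0 // ler_pdivrMr //.
  apply: le_trans (ler_normD _ _) _; apply: le_trans (lerD H D) _.
  rewrite /dyadic_const gtr0_norm ?subr_gt0 // expr1.
  have -> : q / (2 - q) * (K * q) + K * q = q / (2 - q) * K * 2 by field; lra.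
  by [].
exists g => -[|m] k mn.
  rewrite expn0 !muln1 expr0 mulr1 /lift_defect -[k]odd_double_half.
  case: (odd k); rewrite ?add1n ?add0n; set i := k./2; move: (sm i).
    rewrite -[in g _.+1]doubleS gE gO /lift_defect /germ_defect doubleS.
    by congr (`| _ | <= _); field.
  rewrite gE gO /lift_defect /germ_defect doubleS.
  by congr (`| _ | <= _); field.
have dE i : (i * 2 ^ m.+1 = (i * 2 ^ m).*2)%N by rewrite expnS mulnCA mul2n.
rewrite !dE; by have := fP m k mn; rewrite /lift_defect !gE exprS !mulrA.
Qed.

Lemma dyadic_lift n (A : nat -> nat -> R) K : 0 <= K ->
  almost_additive A K -> exists f, forall m k, (m <= n)%N ->
    `|lift_defect A f (k * 2 ^ m)%N (k.+1 * 2 ^ m)%N| <= dyadic_const * K * q ^+ m.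
Proof.
move=> K0 AK; have [q2|q2|/eqP] := ltgtP q 2; last by rewrite (negPf q_neq2).
  exact: dyadic_lift_lt2.
by have [f fP] := dyadic_lift_gt2 q2 K0 AK; exists f.
Qed.

(** The solution b of [c + b + q = b * q], with c the dyadic constant: the fixed point of the
    recursion in [aligned_lift_defect]. *)
Definition aligned_const : R := (dyadic_const + q) / (q - 1).

(** The total in [chained_lift_defect]: b for one end, [c + b + q] for the other, [q] for the germ
    defect that joins them. *)
Definition sewing_const : R := dyadic_const + aligned_const *+ 2 + q *+ 2.

Lemma aligned_const_ge1 : 1 <= aligned_const.
Proof.
rewrite /aligned_const ler_pdivlMr ?subr_gt0 // mul1r.
by have := dyadic_const_ge0; have := q_gt1; lra.
Qed.

Lemma sewing_const_ge0 : 0 <= sewing_const.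
Proof.
have := dyadic_const_ge0; have := aligned_const_ge1; have := q_ge0.
rewrite /sewing_const.
by rewrite !mulr2n; lra.
Qed.

Section Chaining.
Variables (n : nat) (A : nat -> nat -> R) (K : R) (f : nat -> R).
Hypotheses (K_ge0 : 0 <= K) (AK : almost_additive A K).
Hypothesis fP : forall m k, (m <= n)%N ->
  `|lift_defect A f (k * 2 ^ m)%N (k.+1 * 2 ^ m)%N| <= dyadic_const * K * q ^+ m.

(** Binary expansion of [r] from its highest digit: a digit 1 splits off a full dyadic cell,
    controlled by [fP], and leaves a shorter remainder that starts at its right end. *)
Lemma aligned_lift_defect m k r : (m <= n)%N -> (r < 2 ^ m)%N ->
  `|lift_defect A f (k * 2 ^ m)%N (k * 2 ^ m + r)%N| <= aligned_const * K * q ^+ m.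
Proof.
elim: m k r => [|m IH] k r mn rm.
  have -> : r = 0%N by case: r rm.
  have := @AK 0%N k k k; rewrite leqnn subnn => /(_ isT isT).
  rewrite addn0 muln1 expr0 !mulr1 /lift_defect /germ_defect !subrr !add0r => H.
  by apply: le_trans H _; rewrite ler_peMl // aligned_const_ge1.
have x0 := exprn_ge0 m q_ge0.
have kE : (k * 2 ^ m.+1 = k.*2 * 2 ^ m)%N by rewrite expnS mulnA muln2.
have A0 := aligned_const_ge1.
have [rm'|mr] := ltnP r (2 ^ m).
  rewrite kE; apply: le_trans (IH _ _ (ltnW mn) rm') _.
  apply: ler_wpM2l; first by apply: mulr_ge0 => //; exact: le_trans ler01 A0.
  by rewrite exprS ler_peMl // ltW.
rewrite (lift_defectD _ _ _ (k.*2.+1 * 2 ^ m)%N).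
have D : `|germ_defect A (k * 2 ^ m.+1)%N (k.*2.+1 * 2 ^ m)%N (k * 2 ^ m.+1 + r)%N|
    <= K * q ^+ m.+1.
  apply: AK; last by rewrite addKn ltnW.
  by rewrite kE leq_mul2r leqnSn orbT /= mulSn addnC leq_add2l.
have H1 := fP k.*2 (ltnW mn).
have rm2 : (r - 2 ^ m < 2 ^ m)%N by rewrite ltn_subLR // addnn -mul2n -expnS.
have := IH k.*2.+1 _ (ltnW mn) rm2.
have -> : (k.*2.+1 * 2 ^ m + (r - 2 ^ m) = k * 2 ^ m.+1 + r)%N.
  by rewrite kE mulSn; lia.
move=> H2; rewrite -kE in H1.
apply: le_trans (ler_normB _ _) _; apply: le_trans (lerD (ler_normD _ _) (lexx _)) _.
apply: le_trans (lerD (lerD H1 H2) D) _.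
rewrite exprS; move: (q ^+ m) x0 => x x0; rewrite /aligned_const.
rewrite le_eqVlt; apply/orP; left; apply/eqP.
by field; rewrite subr_eq0 gt_eqF.
Qed.

(** Both ends are measured from the left end of the level [m] cell of [i]. As [j - i < 2 ^ m], the
    point [j] lies in that cell or in the next one. *)
Lemma chained_lift_defect m i j : (m <= n)%N -> (i <= j)%N -> (j - i < 2 ^ m)%N ->
  `|lift_defect A f i j| <= sewing_const * K * q ^+ m.
Proof.
move=> mn ij jim.
have [k [r [iE rm]]] : exists k r, i = (k * 2 ^ m + r)%N /\ (r < 2 ^ m)%N.
  by exists (i %/ 2 ^ m)%N, (i %% 2 ^ m)%N; rewrite -divn_eq ltn_mod expn_gt0.
have x0 := exprn_ge0 m q_ge0.
have A0 := aligned_const_ge1; have D0 := dyadic_const_ge0.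
have Hi := aligned_lift_defect k mn rm; rewrite -iE in Hi.
have D : `|germ_defect A (k * 2 ^ m)%N i j| <= K * q ^+ m.+1.
  apply: AK; rewrite ?ij ?expnS ?iE ?leq_addr //.
  by move: ij jim rm; rewrite iE; clear; move: (2 ^ m)%N (k * _)%N => M p; lia.
have Hj : `|lift_defect A f (k * 2 ^ m)%N j| <=
    (dyadic_const + aligned_const + q) * K * q ^+ m.
  have [jm|mj] := ltnP j (k.+1 * 2 ^ m).
    have jk : (k * 2 ^ m <= j)%N by apply: leq_trans _ ij; rewrite iE leq_addr.
    have := @aligned_lift_defect m k (j - k * 2 ^ m) mn; rewrite subnKC // => H.
    apply: le_trans (H _) _; first by rewrite ltn_subLR // addnC -mulSn.
    by do 2![apply: ler_wpM2r => //]; rewrite addrAC lerDr addr_ge0.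
  rewrite (lift_defectD _ _ _ (k.+1 * 2 ^ m)%N).
  have := @aligned_lift_defect m k.+1 (j - k.+1 * 2 ^ m) mn; rewrite subnKC // => H.
  have jk : (j - k.+1 * 2 ^ m < 2 ^ m)%N.
    by move: ij jim rm mj; rewrite iE mulSn; clear; move: (2 ^ m)%N (k * _)%N => M p; lia.
  have {H jk} H2 := H jk.
  have D' : `|germ_defect A (k * 2 ^ m)%N (k.+1 * 2 ^ m)%N j| <= K * q ^+ m.+1.
    apply: AK; first by rewrite mulSn leq_addl -mulSn.
    move: ij jim rm mj; rewrite iE mulSn expnS; clear.
    by move: (2 ^ m)%N (k * _)%N => M p; lia.
  apply: le_trans (ler_normB _ _) _; apply: le_trans (lerD (ler_normD _ _) (lexx _)) _.
  apply: le_trans (lerD (lerD (fP k mn) H2) D') _.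
  rewrite exprS le_eqVlt; apply/orP; left; apply/eqP; ring.
have -> : lift_defect A f i j = lift_defect A f (k * 2 ^ m)%N j -
    lift_defect A f (k * 2 ^ m)%N i + germ_defect A (k * 2 ^ m)%N i j.
  by rewrite (lift_defectD _ _ (k * 2 ^ m)%N i); ring.
apply: le_trans (ler_normD _ _) _; apply: le_trans (lerD (ler_normB _ _) (lexx _)) _.
apply: le_trans (lerD (lerD Hj Hi) D) _.
by rewrite exprS le_eqVlt; apply/orP; left; apply/eqP; rewrite /sewing_const; ring.
Qed.

End Chaining.

Lemma discrete_sewing n (A : nat -> nat -> R) K : 0 <= K -> almost_additive A K ->
  exists f, forall m i j, (m <= n)%N -> (i <= j)%N -> (j - i < 2 ^ m)%N ->
    `|lift_defect A f i j| <= sewing_const * K * q ^+ m.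
Proof.
move=> K0 AK; have [f fP] := dyadic_lift n K0 AK.
by exists f => m i j; apply: chained_lift_defect.
Qed.

End DiscreteSewing.

(** * Upper limits of eventually bounded real sequences *)

Section UpperLimit.
Variable R : realType.
Implicit Types (x y : nat -> R) (b c : R).

Definition eventual_bounds x : set R :=
  [set b | exists n0, forall n, (n0 <= n)%N -> x n <= b]%classic.

(** An upper limit rather than a limit: the discrete lifts on successive grids are chosen
    independently of each other and need not converge. *)
Definition upper_limit x : R := inf (eventual_bounds x).

Definition eventually_bounded x :=
  exists b n0, forall n, (n0 <= n)%N -> `|x n| <= b.

Lemma eventual_bounds_has_inf x : eventually_bounded x -> has_inf (eventual_bounds x).
Proof.
move=> [b [n0 xb]]; split.
  by exists b, n0 => n /xb; rewrite ler_norml => /andP[].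
exists (- b) => c [n1 xc]; have := xb _ (leq_maxl n0 n1).
by rewrite ler_norml => /andP[+ _] => /le_trans; apply; exact/xc/leq_maxr.
Qed.

Lemma upper_limit_leD x y c : eventually_bounded x -> eventually_bounded y ->
  (exists n0, forall n, (n0 <= n)%N -> x n <= y n + c) ->
  upper_limit x <= upper_limit y + c.
Proof.
move=> xB yB [n0 xy]; rewrite -lerBlDr.
apply: lb_le_inf => [|b [n1 yb]]; first by case: (eventual_bounds_has_inf yB).
rewrite lerBlDr; apply: ge_inf; first by case: (eventual_bounds_has_inf xB).
exists (maxn n0 n1) => n; rewrite geq_max => /andP[/xy/le_trans + /yb ynb].
by apply; rewrite lerD2r.
Qed.

(** Upper limits are not additive, but they are monotone and commute with adding a constant, which
    gives both sides of the estimate. *)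
Lemma upper_limit_dist x y c e : eventually_bounded x -> eventually_bounded y ->
  (exists n0, forall n, (n0 <= n)%N -> `|x n - y n - c| <= e) ->
  `|upper_limit x - upper_limit y - c| <= e.
Proof.
move=> xB yB [n0 xy]; rewrite ler_norml.
have := @upper_limit_leD x y (c + e) xB yB.
have := @upper_limit_leD y x (e - c) yB xB.
have L1 n : (n0 <= n)%N -> x n <= y n + (c + e).
  by move=> /xy; rewrite ler_norml => /andP[_]; lra.
have L2 n : (n0 <= n)%N -> y n <= x n + (e - c).
  by move=> /xy; rewrite ler_norml => /andP[+ _]; lra.
move=> /(_ (ex_intro _ n0 L2)) + /(_ (ex_intro _ n0 L1)).
by clear; lra.
Qed.

End UpperLimit.

(** * Sewing on the unit interval, for an exponent other than 1 *)

Section Sewing.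
Variables (R : realType) (a : R).
Hypotheses (a_gt0 : 0 < a) (a_neq1 : a != 1).

Let q : R := 2 `^ a.

Let q_gt1 : 1 < q.
Proof.
rewrite lt_neqAle eq_sym powR_eq1 !negb_or gt_eqF ?ltr1n //= ltrn0 /= (gt_eqF a_gt0) /=.
by rewrite -{1}(powRr0 (2 : R)) ler_powR ?ler1n // ltW.
Qed.

(** The exclusion of [a = 1] enters here, to keep the denominator of [dyadic_const] away from
    zero. *)
Let q_neq2 : q != 2.
Proof.
apply: contraNneq a_neq1 => q2; have /esym := powR_eq1 (2 : R) (a - 1).
rewrite powRB ?pnatr_eq0 ?implybT // -/q q2 powRr1 // divff ?pnatr_eq0 // eqxx.
by rewrite ltrn0 subr_eq0 pnatr_eq1.
Qed.

Let h : R := 2^-1.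

Let h_ge0 n : 0 <= h ^+ n. Proof. by rewrite exprn_ge0 // invr_ge0. Qed.

Let hK n : 2 ^+ n * h ^+ n = 1.
Proof. by rewrite -exprMn mulfV ?pnatr_eq0 // expr1n. Qed.

Let powR_exp b n : 0 <= b -> (b ^+ n) `^ a = (b `^ a) ^+ n.
Proof.
by move=> b0; rewrite -(powR_mulrn n b0) -(powR_mulrn n (powR_ge0 b a)) -!powRrM mulrC.
Qed.

Let powR_scale n : (h ^+ n) `^ a = q ^- n.
Proof.
rewrite powR_exp ?invr_ge0 // -exprVn; congr (_ ^+ n); apply: (@mulfI _ q).
  by rewrite gt_eqF // (lt_trans ltr01).
rewrite -powRM ?invr_ge0 // mulfV ?pnatr_eq0 // powR1 mulfV //.
by rewrite gt_eqF // (lt_trans ltr01).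
Qed.

Variables (A : R -> R -> R) (K : R).
Hypothesis AK : forall s u t, `|germ_defect A s u t| <= K * (`|u - s| + `|t - u|) `^ a.

Let K_ge0 : 0 <= K.
Proof.
have := AK 0 0 1; rewrite subrr normr0 add0r subr0 normr1 powR1 mulr1.
exact: le_trans.
Qed.

Let germ_diag s : A s s = 0.
Proof.
have := AK s s s; rewrite subrr normr0 addr0 powR0 ?gt_eqF // mulr0 normr_le0.
by rewrite /germ_defect subrr add0r oppr_eq0 => /eqP.
Qed.

Let germ_defect_le s u t r : s <= u <= t -> t - s <= r ->
  `|germ_defect A s u t| <= K * r `^ a.
Proof.
move=> /andP[su ut] tsr; apply: le_trans (AK _ _ _) _.
rewrite !ger0_norm ?subr_ge0 // addrC addrA subrK ler_wpM2l //.
have ts : 0 <= t - s by rewrite subr_ge0 (le_trans su).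
by apply: ge0_ler_powR; rewrite ?nnegrE //; [exact: ltW | exact: le_trans tsr].
Qed.

Let grid n i : R := i%:R * h ^+ n.

Let grid_almost_additive n :
  almost_additive q (fun i j => A (grid n i) (grid n j)) (K * q ^- n).
Proof.
move=> m i k j /andP[ik kj] jim.
apply: le_trans (@germ_defect_le (grid n i) (grid n k) (grid n j) (2 ^+ m * h ^+ n) _ _) _.
- by rewrite !ler_wpM2r // ler_nat.
- by rewrite -mulrBl ler_wpM2r // -natrB ?(leq_trans ik) // -natrX ler_nat.
rewrite powRM ?h_ge0 ?exprn_ge0 // powR_scale powR_exp // -/q.
by rewrite -[leRHS]mulrA [q ^- n * _]mulrC.
Qed.

Let grid_trunc n (t : R) : nat := Num.truncn (t * 2 ^+ n).

Let grid_truncP n t : 0 <= t -> grid n (grid_trunc n t) <= t < grid n (grid_trunc n t) + h ^+ n.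
Proof.
move=> t0; have := truncn_itv (mulr_ge0 t0 (exprn_ge0 n (ler0n R 2))).
have h0 : 0 < h ^+ n by rewrite exprn_gt0 // invr_gt0.
rewrite -/(grid_trunc n t) -(ler_pM2r h0) -(ltr_pM2r h0) -mulrA hK mulr1.
by rewrite -natr1 mulrDl mul1r.
Qed.

(** The factor [q ^- n] accounts for the mesh [h ^+ n]. The two levels beyond [n] leave room for
    rounding in [grid_lift_close], where indices differ by less than [2 ^ (n - l).+2]. *)
Let discrete_lift_exists n : exists f : nat -> R, forall m i j, (m <= n.+2)%N ->
  (i <= j)%N -> (j - i < 2 ^ m)%N ->
  `|lift_defect (fun i j => A (grid n i) (grid n j)) f i j| <=
    sewing_const q * (K * q ^- n) * q ^+ m.
Proof.
have K0 : 0 <= K * q ^- n.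
  by rewrite mulr_ge0 // invr_ge0 exprn_ge0 // ltW // (lt_trans ltr01).
exact: (discrete_sewing q_gt1 q_neq2 n.+2 K0 (grid_almost_additive n)).
Qed.

Let scale_exists r : 0 < r <= 1 -> exists l, r <= h ^+ l <= 2 * r.
Proof.
move=> /andP[r0 r1].
(* The least such exponent is taken as [l]; its minimality gives [r <= h ^+ l]. *)
have ex : exists n, h ^+ n.+1 <= r.
  exists (Num.truncn r^-1); set n := Num.truncn _.
  have := truncn_itv (ltW (_ : 0 < r^-1)); rewrite invr_gt0 => /(_ r0)/andP[_].
  rewrite -/n => rn; rewrite exprVn invf_ple ?posrE ?exprn_gt0 //.
  by rewrite (le_trans (ltW rn)) // -natrX ler_nat ltnW // ltn_expl.
case: (ex_minnP ex) => l lr lmin; exists l; apply/andP; split; last first.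
  by move: lr; rewrite exprS /h ler_pdivrMl.
case: l lr lmin => [|l] _ lmin; first by rewrite expr0.
by rewrite leNgt; apply/negP => /ltW/lmin; rewrite ltnn.
Qed.

(** The discrete defect at level [(n - l).+2] contributes [sewing_const q * q ^+ 2], and each of two
    germ defects over a length [2 * h ^+ l] contributes [q]. *)
Let germ_diameter : R := (sewing_const q * q ^+ 2 + q *+ 2) * K.

(** Off the grid, the lift is completed by the germ from the grid point just below. The error splits
    into a discrete defect and two germ defects, with a bound independent of [n]. *)
Let grid_lift_close (f : nat -> R) n l s t :
  (forall m i j, (m <= n.+2)%N -> (i <= j)%N -> (j - i < 2 ^ m)%N ->
    `|lift_defect (fun i j => A (grid n i) (grid n j)) f i j| <=
      sewing_const q * (K * q ^- n) * q ^+ m) ->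
  (l <= n)%N -> 0 <= s -> s <= t -> t - s <= h ^+ l ->
  `|f (grid_trunc n t) + A (grid n (grid_trunc n t)) t -
    (f (grid_trunc n s) + A (grid n (grid_trunc n s)) s) - A s t| <=
    germ_diameter * q ^- l.
Proof.
move=> fP ln s0 st tsl; have t0 := le_trans s0 st.
have /andP[s1 s2] := grid_truncP n s0; have /andP[t1 t2] := grid_truncP n t0.
have hl0 : 0 < h ^+ l by rewrite exprn_gt0 // invr_gt0.
have hn0 : 0 < h ^+ n by rewrite exprn_gt0 // invr_gt0.
have q0 : q != 0 by rewrite gt_eqF // (lt_trans ltr01).
have hnl : h ^+ n <= h ^+ l.
  by rewrite ler_wiXn2l ?invr_ge0 ?invf_le1 ?ler1n.
have scale : 2 ^+ (n - l).+2 * h ^+ n = 4 * h ^+ l.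
  have -> : h ^+ n = h ^+ (n - l) * h ^+ l by rewrite -exprD subnK.
  by rewrite mulrA 2!exprS -!mulrA [2 ^+ _ * _]mulrA hK mul1r mulrA -natrM.
have Tst : (grid_trunc n s <= grid_trunc n t)%N.
  by apply: le_truncn; rewrite ler_wpM2r // exprn_ge0.
move: s1 s2 t1 t2; set i := grid_trunc n s; set j := grid_trunc n t => s1 s2 t1 t2.
have tgi : t - grid n i <= 2 * h ^+ l.
  have : t - grid n i = (t - s) + (s - grid n i) by ring.
  move=> ->; rewrite mulrDl mul1r lerD // (le_trans _ hnl) // lerBlDr addrC; exact: ltW.
have gij : grid n i <= grid n j by rewrite ler_wpM2r // ler_nat.
have ijm : (j - i < 2 ^ (n - l).+2)%N.
  rewrite ltn_subLR // -(ltr_nat R) -(ltr_pM2r hn0) natrD natrX mulrDl scale.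
  rewrite -/(grid n i) -/(grid n j) -ltrBlDl.
  apply: le_lt_trans (_ : 2 * h ^+ l < _); last by rewrite ltr_pM2r // ltr_nat.
  by apply: le_trans tgi; rewrite lerD2r.
have D1 : `|germ_defect A (grid n i) s t| <= K * (2 * h ^+ l) `^ a.
  by apply: germ_defect_le; rewrite ?s1.
have D2 : `|germ_defect A (grid n i) (grid n j) t| <= K * (2 * h ^+ l) `^ a.
  by apply: germ_defect_le; rewrite ?gij.
have D3 := fP (n - l).+2 i j (leq_subr l n) Tst ijm.
have -> : f j + A (grid n j) t - (f i + A (grid n i) s) - A s t =
    lift_defect (fun i j => A (grid n i) (grid n j)) f i j +
    germ_defect A (grid n i) s t - germ_defect A (grid n i) (grid n j) t.
  by rewrite /lift_defect /germ_defect; ring.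
apply: le_trans (ler_normB _ _) _; apply: le_trans (lerD (ler_normD _ _) (lexx _)) _.
apply: le_trans (lerD (lerD D3 D1) D2) _.
rewrite powRM ?h_ge0 // powR_scale -/q /germ_diameter.
have -> : q ^+ (n - l).+2 = q ^+ 2 * q ^+ n * q ^- l.
  rewrite -[(n - l).+2]addn2 exprD mulrC -mulrA; congr (_ * _).
  by rewrite -[in RHS](subnK ln) exprD mulfK ?expf_neq0.
rewrite le_eqVlt; apply/orP; left; apply/eqP.
by field; rewrite !expf_neq0.
Qed.

Lemma sewing : exists f C, forall s t, 0 <= s <= 1 -> 0 <= t <= 1 ->
  `|lift_defect A f s t| <= C * `|t - s| `^ a.
Proof.
have [fn fnP] := choice discrete_lift_exists.
(* Subtracting [fn n 0] makes every approximation vanish at 0, so that the values at each [t] stay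
   bounded as [n] grows. *)
pose x t n := fn n (grid_trunc n t) + A (grid n (grid_trunc n t)) t - fn n 0%N.
have key l s t : 0 <= s -> s <= t -> t - s <= h ^+ l -> exists n0, forall n, (n0 <= n)%N ->
    `|x t n - x s n - A s t| <= germ_diameter * q ^- l.
  move=> s0 st tsl; exists l => n ln; have := grid_lift_close (fnP n) ln s0 st tsl.
  by rewrite /x opprB addrA subrK.
have bounded t : 0 <= t <= 1 -> eventually_bounded (x t).
  move=> /andP[t0 t1]; have [|n0 n0P] := key 0%N 0 t (lexx _) t0.
    by rewrite subr0 expr0.
  exists (germ_diameter * q ^- 0 + `|A 0 t|), n0 => n /n0P xn.
  have x0 : x 0 n = 0.
    by rewrite /x /grid_trunc mul0r truncn0 /grid mul0r germ_diag addr0 subrr.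
  rewrite x0 subr0 in xn; rewrite -(subrK (A 0 t) (x t n)).
  by apply: le_trans (ler_normD _ _) _; rewrite lerD2r.
(* The factor [q] comes from [h ^+ l <= 2 * (t - s)]: it bounds [q ^- l] by [q] times the a-th power
   of [t - s]. *)
pose C := germ_diameter * q; pose f t := upper_limit (x t).
have lift s t : 0 <= s <= 1 -> 0 <= t <= 1 -> s < t ->
    `|lift_defect A f s t| <= C * (t - s) `^ a.
  move=> s01 t01 st; have [/andP[s0 s1] /andP[t0 t1]] := (s01, t01).
  have [|l /andP[l1 l2]] := @scale_exists (t - s).
    by rewrite subr_gt0 st /= lerBlDr (le_trans t1) // lerDl.
  apply: le_trans (upper_limit_dist (bounded t t01) (bounded s s01) (key l s t s0 (ltW st) l1)) _.
  have c0 : 0 <= germ_diameter.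
    have q0 : 0 <= q by rewrite ltW // (lt_trans ltr01).
    by rewrite mulr_ge0 // addr_ge0 ?mulrn_wge0 ?mulr_ge0 ?sewing_const_ge0 ?exprn_ge0.
  have ts0 : 0 <= t - s by rewrite subr_ge0 ltW.
  rewrite /C -mulrA ler_wpM2l // -powR_scale /q -powRM //.
  by apply: ge0_ler_powR => //; rewrite ?nnegrE ?mulr_ge0 // ltW.
(* The extra [K * q] pays for decreasing pairs: reversing a pair costs the germ defect of [t], [s],
   [t], over a total length [2 * |t - s|]. *)
exists f, (C + K * q) => s t s01 t01.
have [st|ts|->] := ltgtP s t; last 2 first.
- have -> : lift_defect A f s t = germ_defect A t s t - lift_defect A f t s.
    by rewrite /lift_defect /germ_defect germ_diag; ring.
  apply: le_trans (ler_normB _ _) _; rewrite mulrDl [leLHS]addrC lerD //.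
    by rewrite [ `|t - s|]distrC [ `|s - t|]gtr0_norm ?subr_gt0 //; apply: lift.
  apply: le_trans (AK _ _ _) _; rewrite -mulrA ler_wpM2l // [ `|s - t|]distrC.
  by rewrite -mulr2n -mulr_natl powRM.
- rewrite subrr normr0 powR0 ?gt_eqF // mulr0.
  by rewrite /lift_defect subrr germ_diag subr0 normr0.
rewrite [ `|t - s|]gtr0_norm ?subr_gt0 // (le_trans (lift _ _ s01 t01 st)) //.
by rewrite ler_wpM2r ?powR_ge0 // lerDl mulr_ge0 // ltW // (lt_trans ltr01).
Qed.

End Sewing.

(** * Hölder lifts of cocycles: existence, differences and uniqueness *)

Section HolderLift.
Variable R : realType.
Local Notation I := (unit_interval R).
Local Notation i0 := (unit_interval0 R).
Implicit Types (H : I -> I -> I -> R) (F : I -> I -> R) (f : I -> R) (s u t v : I).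

Lemma ger0_le_powR (a x y : R) : 0 <= a -> 0 <= x -> x <= y -> x `^ a <= y `^ a.
Proof. by move=> a0 x0 xy; apply: ge0_ler_powR; rewrite ?nnegrE // (le_trans x0). Qed.

Definition holder_lift (a : R) H F :=
  (forall s u t, F s t = F s u + F u t + H s u t) /\
  exists C, forall s t, `|F s t| <= C * `|val t - val s| `^ a.

(** Necessary for a lift [F] to exist: it compares the two ways to expand [F s v] through [u] and
    [t]. *)
Definition cocycle H := forall s u t v, H s u t + H s t v = H s u v + H u t v.

Definition holder_bounded3 (a : R) H :=
  exists K, forall s u t,
    `|H s u t| <= K * (`|val u - val s| + `|val t - val u|) `^ a.

Lemma clamp_subproof (x : R) : 0 <= Num.max 0 (Num.min x 1) <= 1.
Proof. by rewrite le_max lexx ge_max ler01 ge_min lexx orbT. Qed.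

(** This retraction extends germs from the interval to the whole line, as grids have points beyond
    1; being 1-Lipschitz, it keeps the bounds. *)
Definition clamp (x : R) : I :=
  exist (fun y : R => is_true (0 <= y <= 1)) _ (clamp_subproof x).

Lemma clamp_val s : clamp (val s) = s.
Proof.
apply: val_inj => /=; have /andP[s0 s1] := valP s.
by rewrite min_l // max_r.
Qed.

Lemma clamp_dist (x y : R) : `|val (clamp x) - val (clamp y)| <= `|x - y|.
Proof.
wlog xy : x y / x <= y.
  move=> W; have [xy|/ltW yx] := leP x y; first exact: W.
  by rewrite distrC [leRHS]distrC; apply: W.
rewrite !ler0_norm ?subr_le0 //=; last first.
  by rewrite ge_max le_max lexx le_max /= le_min !ge_min xy lexx !orbT.
rewrite !opprB /Num.max /Num.min.
case: (ltP x 1); case: (ltP y 1); case: (ltP 0 x); case: (ltP 0 y); rewrite ?ltr01; lra.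
Qed.

(** The germ [H i0 x y] has defect [- H] by the cocycle relation, so the lift defect of its sewing
    satisfies the lift equation exactly and is small. *)
Lemma holder_lift_exists (a : R) H : 0 < a -> a != 1 -> cocycle H ->
  holder_bounded3 a H -> exists F, holder_lift a H F.
Proof.
move=> a0 a1 Hc [K HK]; pose A x y := H i0 (clamp x) (clamp y).
have AH x y z : germ_defect A x y z = - H (clamp x) (clamp y) (clamp z).
  have := Hc i0 (clamp x) (clamp y) (clamp z); rewrite /germ_defect /A => E.
  by rewrite -addrA -opprD E opprD addNKr.
have K0 : 0 <= K.
  have := HK i0 i0 (clamp 1); rewrite subrr normr0 add0r.
  rewrite /= minxx max_r // subr0 normr1 powR1 mulr1; exact: le_trans.
have AK x y z : `|germ_defect A x y z| <= K * (`|y - x| + `|z - y|) `^ a.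
  rewrite AH normrN; apply: le_trans (HK _ _ _) _; rewrite ler_wpM2l //.
  by apply: ger0_le_powR; rewrite ?addr_ge0 ?lerD ?clamp_dist // ltW.
have [f [C fC]] := sewing a0 a1 AK.
exists (fun s t => lift_defect A f (val s) (val t)); split.
  by move=> s u t; rewrite (lift_defectD _ _ _ (val u)) AH !clamp_val opprK.
by exists C => s t; exact: fC (valP s) (valP t).
Qed.

(** [H] cancels in [F - F'], which is therefore additive, hence the increment of its values from
    time 0. *)
Lemma holder_lift_diff (a : R) H F F' : holder_lift a H F -> holder_lift a H F' ->
  [/\ holder a (fun t => F i0 t - F' i0 t), F i0 i0 - F' i0 i0 = 0 &
      forall s t, F s t = F' s t + (F i0 t - F' i0 t) - (F i0 s - F' i0 s)].
Proof.
move=> [Fc [C FC]] [F'c [C' FC']].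
have D s t : F s t = F' s t + (F i0 t - F' i0 t) - (F i0 s - F' i0 s).
  by rewrite (Fc i0 s t) (F'c i0 s t); ring.
split=> //; last by rewrite {1}(D i0 i0); ring.
exists (C + C') => s t; rewrite mulrDl.
have -> : F i0 t - F' i0 t - (F i0 s - F' i0 s) = F s t - F' s t by rewrite (D s t); ring.
by rewrite (le_trans (ler_normB _ _)) // lerD.
Qed.

Lemma holder_lift_shift (a : R) H F f : holder_lift a H F -> holder a f ->
  holder_lift a H (fun s t => F s t + f t - f s).
Proof.
move=> [Fc [C FC]] [C' fC]; split=> [s u t|]; first by rewrite (Fc s u t); ring.
exists (C + C') => s t; rewrite -addrA mulrDl.
by rewrite (le_trans (ler_normD _ _)) // lerD.
Qed.

Lemma midpoint_subproof s t : 0 <= (val s + val t) / 2 <= 1.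
Proof.
have /andP[s0 s1] := valP s; have /andP[t0 t1] := valP t; move: s0 s1 t0 t1.
by move: (val s) (val t) => x y *; lra.
Qed.

Definition midpoint s t : I :=
  exist (fun y : R => is_true (0 <= y <= 1)) _ (midpoint_subproof s t).

(** Each bisection gains a factor [2 ^ (1 - a) < 1] in the bound on an increment, so iterating it
    forces the increment to vanish. *)
Lemma holder_gt1_const (a : R) f : 1 < a -> holder a f -> forall s t, f s = f t.
Proof.
move=> a1 [C fC] s t; set e := a - 1; have e0 : 0 < e by rewrite subr_gt0.
have a0 : 0 <= a by rewrite ltW // (lt_trans ltr01).
have fn n s' t' : `|f t' - f s'| <= C * `|val t' - val s'| `^ a / ((2 ^+ n) `^ e).
  elim: n s' t' => [|n IH] s' t'; first by rewrite expr0 powR1 divr1.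
  rewrite -(subrKA (f (midpoint s' t'))); apply: le_trans (ler_normD _ _) _.
  apply: le_trans (lerD (IH _ _) (IH _ _)) _ => /=.
  have -> : val t' - (val s' + val t') / 2 = (val t' - val s') / 2 by field.
  have -> : (val s' + val t') / 2 - val s' = (val t' - val s') / 2 by field.
  have half : (2^-1 : R) `^ a * 2 = (2 `^ e)^-1.
    rewrite -[X in X `^ a]powR_inv1 // -powRrM -[X in _ * X]powRr1 // -powRD.
      by rewrite -powRN; congr (_ `^ _); rewrite /e; ring.
    by rewrite pnatr_eq0 implybT.
  have h0 : 0 <= 2^-1 :> R by rewrite invr_ge0.
  rewrite normrM (ger0_norm h0) (powRM _ (normr_ge0 _) h0) exprS.
  rewrite [in leRHS]powRM ?exprn_ge0 //.
  rewrite invfM -half -mulr2n -mulr_natr le_eqVlt; apply/orP; left; apply/eqP; ring.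
apply/eqP; rewrite eq_sym -subr_eq0 -normr_le0 leNgt; apply/negP => fst.
set Y := C * `|val t - val s| `^ a; set x := `|f t - f s|.
have xY n : x * (2 ^+ n) `^ e <= Y.
  by rewrite -ler_pdivlMr ?fn // powR_gt0 // exprn_gt0.
have Y0 : 0 <= Y / x.
  have Yge0 : 0 <= Y := le_trans (mulr_ge0 (normr_ge0 _) (powR_ge0 _ _)) (xY 0%N).
  by rewrite divr_ge0 // /x.
(* As the power [e] of [M] is [Y / x], any [n] with [M < 2 ^+ n] contradicts [xY]. *)
pose M := (Y / x) `^ e^-1; have M0 : 0 <= M := powR_ge0 _ _.
have ME : M `^ e = Y / x by rewrite -powRrM mulVf ?gt_eqF // powRr1.
pose n := Num.truncn M; have /andP[_ Mn] := truncn_itv M0.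
have M2 : M < 2 ^+ n by rewrite (lt_le_trans Mn) // -natrX ler_nat ltn_expl.
have := xY n; rewrite leNgt => /negP; apply.
rewrite mulrC -ltr_pdivrMr // -ME.
by apply: gt0_ltr_powR; rewrite ?nnegrE ?exprn_ge0.
Qed.

Lemma holder_lift_unique (a : R) H F F' : 1 < a ->
  holder_lift a H F -> holder_lift a H F' -> forall s t, F s t = F' s t.
Proof.
move=> a1 HF HF' s t; have [hf _ ->] := holder_lift_diff HF HF'.
by rewrite (holder_gt1_const a1 hf s t) addrK.
Qed.

(* Equal to [0] if [H] has no lift. *)
Definition base_lift (a : R) H : I -> I -> R :=
  xget (fun _ _ => 0) [set F | holder_lift a H F]%classic.

Lemma base_liftP (a : R) H : 0 < a -> a != 1 -> cocycle H ->
  holder_bounded3 a H -> holder_lift a H (base_lift a H).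
Proof.
move=> a0 a1 Hc HK; have [F HF] := holder_lift_exists a0 a1 Hc HK.
exact: (@xgetPex _ (fun _ _ => 0) [set F | holder_lift a H F]%classic (ex_intro _ F HF)).
Qed.

End HolderLift.

(* [tuple.tsize] would otherwise shadow the number of nodes of a tree. *)
Local Notation tsize := Defs.tsize.

(** * Containment of trees: transitivity and sizes *)

Section Contains.
Variable d : nat.
Implicit Types (t a b : ptree d) (tau rho sigma : tree d).

Lemma subtreesE (i : 'I_d) s :
  subtrees (PNode i s) = rsubtrees (PNode i s) ++ flatten [seq subtrees u | u <- s].
Proof. by []. Qed.

Lemma choices_mem (T : eqType) (ls : seq (seq T)) v x :
  v \in choices ls -> x \in v -> exists2 l, l \in ls & x \in l.
Proof.
elim: ls v => [|l ls IH] v /=; first by rewrite inE => /eqP ->.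
rewrite mem_cat => /orP[vl /(IH _ vl)[m mls xm]|].
  by exists m; rewrite // inE mls orbT.
case/allpairsP => -[y w] [/= yl wls ->]; rewrite inE => /predU1P[->|xw].
  by exists l; rewrite ?mem_head.
by have [m mls xm] := IH _ wls xw; exists m; rewrite // inE mls orbT.
Qed.

Lemma rsubtrees_refl t : t \in rsubtrees t.
Proof.
elim/ptree_ind_mem: t => i s IH /=; apply: map_f.
elim: s IH => [|u s IHs] IH; first exact: mem_head.
rewrite /= mem_cat; apply/orP; right; apply/allpairsP; exists (u, s); split=> //=.
  by apply: IH; rewrite mem_head.
by apply: IHs => x xs; apply: IH; rewrite inE xs orbT.
Qed.

Lemma subtrees_rsubtrees t a : a \in rsubtrees t -> a \in subtrees t.
Proof. by case: t => i s at_; rewrite subtreesE mem_cat at_. Qed.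

Lemma subtrees_refl t : t \in subtrees t.
Proof. exact: subtrees_rsubtrees (rsubtrees_refl t). Qed.

Lemma rsubtrees_trans t a b : a \in rsubtrees t -> b \in rsubtrees a -> b \in rsubtrees t.
Proof.
elim/ptree_ind_mem: t a b => i s IH a b /mapP[v vs ->] /mapP[w wv ->] /=.
apply: map_f; elim: s v w IH vs wv => [|u s IHs] v w IH /=.
  by rewrite inE => /eqP ->.
have {}IHs v' w' := IHs v' w' (fun x xs => IH x (mem_behead (s := u :: s) xs)).
rewrite !mem_cat => /orP[vs wv|]; first by rewrite (IHs v).
case/allpairsP => -[x v'] [/= xu v's -> /=].
rewrite mem_cat => /orP[wv|]; first by rewrite (IHs v').
case/allpairsP => -[y w'] [/= yx w'v' ->].
apply/orP; right; apply/allpairsP; exists (y, w'); split=> //=; last exact: IHs v's w'v'.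
exact: IH (mem_head _ _) _ _ xu yx.
Qed.

(** A subtree of [a] that avoids its root lies in a branch of [a], and that branch is a root subtree
    of a branch of [t]. *)
Lemma subtrees_rtrans t a b : a \in rsubtrees t -> b \in subtrees a -> b \in subtrees t.
Proof.
elim/ptree_ind_mem: t a b => i s IH a b at_; move: (at_) => /mapP[v vs aE].
rewrite aE subtreesE -aE mem_cat => /orP[/(rsubtrees_trans at_)/subtrees_rsubtrees//|].
case/flatten_mapP => x xv bx; have [_ /mapP[u us ->] xu] := choices_mem vs xv.
rewrite subtreesE mem_cat; apply/orP; right; apply/flatten_mapP; exists u => //.
exact: IH xu bx.
Qed.

Lemma subtrees_trans t a b : a \in subtrees t -> b \in subtrees a -> b \in subtrees t.
Proof.
elim/ptree_ind_mem: t a b => i s IH a b; rewrite {1}subtreesE mem_cat => /orP[].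
  exact: subtrees_rtrans.
case/flatten_mapP => u us au ba; rewrite subtreesE mem_cat; apply/orP; right.
by apply/flatten_mapP; exists u; rewrite // (IH u us a).
Qed.

Lemma psize_rsubtrees t a : a \in rsubtrees t -> (psize a <= psize t)%N.
Proof.
elim/ptree_ind_mem: t a => i s IH a /mapP[v vs ->] /=; rewrite ltnS.
elim: s v IH vs => [|u s IHs] v IH /=; first by rewrite inE => /eqP ->.
have {}IHs v' := IHs v' (fun x xs => IH x (mem_behead (s := u :: s) xs)).
rewrite mem_cat => /orP[/IHs/leq_trans->//|]; first exact: leq_addl.
by case/allpairsP => -[x w] [/= /(IH u (mem_head _ _)) xu /IHs ws ->]; apply: leq_add.
Qed.

Lemma psize_subtrees t a : a \in subtrees t -> (psize a <= psize t)%N.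
Proof.
elim/ptree_ind_mem: t a => i s IH a; rewrite subtreesE mem_cat => /orP[/psize_rsubtrees//|].
case/flatten_mapP => u us /(IH u us)/leq_trans; apply => /=; apply: ltnW.
rewrite ltnS; elim: s us {IH} => //= x s IHs; rewrite inE => /predU1P[->|/IHs/leq_trans->//].
  exact: leq_addr.
exact: leq_addl.
Qed.

Lemma containsP t tau :
  reflect (exists2 a, tau = \pi_(tree d)%qT a & a \in subtrees t) (contains (\pi_(tree d)%qT t) tau).
Proof.
rewrite contains_pi; apply: (iffP mapP) => -[a]; first by exists a.
by move=> -> at_; exists a.
Qed.

Lemma contains_trans sigma rho tau :
  contains sigma rho -> contains rho tau -> contains sigma tau.
Proof.
elim/quotW: sigma => t /containsP[a -> at_] /containsP[b -> ba].
by apply/containsP; exists b => //; apply: subtrees_trans ba.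
Qed.

Lemma contains_tsize sigma tau : contains sigma tau -> (tsize tau <= tsize sigma)%N.
Proof.
by elim/quotW: sigma => t /containsP[a -> /psize_subtrees]; rewrite !tsize_pi.
Qed.

Lemma tsize_gt0 tau : (0 < tsize tau)%N.
Proof. by elim/quotW: tau => -[i s]; rewrite tsize_pi. Qed.

Lemma tree_ind_graft (P : tree d -> Prop) :
  (forall i f, {in forest_seq f, forall tau, P tau} -> P (graft i f)) -> forall tau, P tau.
Proof.
move=> H; elim/quotW; elim/ptree_ind_mem => i s IH; rewrite -graftE; apply: H.
by move=> tau; rewrite (perm_mem (perm_forest_seq _)) => /mapP[t /IH Pt ->].
Qed.

Lemma tsize_fsize (f : forest d) tau : tau \in forest_seq f -> (tsize tau <= fsize f)%N.
Proof.
rewrite /fsize; elim: (forest_seq f) => //= x s IHs; rewrite inE => /predU1P[->|/IHs/leq_trans->//].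
  exact: leq_addr.
exact: leq_addl.
Qed.

End Contains.

(** * The terms of the coproduct, described as cuts *)

Section CoproductShape.
Variables (R : comNzRingType) (d : nat).
Local Notation H2 := (hopf2 R d).
Local Notation pair := (forest d * forest d)%type.
Local Notation "\pi t" := (\pi_(tree d)%qT t) (at level 10, t at level 9).
Implicit Types (t a : ptree d) (s v : seq (ptree d)).

(** The term with first factor [mone] is the empty cut. Listing the others with repetition counts
    their multiplicities, so no coefficients occur. *)
Definition leading (z : H2) (q : forest d) (P : pair -> Prop) :=
  exists2 l : seq pair, z = of_pair R mone q + \sum_(c <- l) of_pair R c.1 c.2 &
    forall c, c \in l -> P c.

Lemma of_pairM (p q p' q' : forest d) :
  of_pair R p q * of_pair R p' q' = of_pair R (mmul p p') (mmul q q').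
Proof. by rewrite /of_pair -mbasisM. Qed.

Lemma leadingM z z' q q' (P P' Q : pair -> Prop) :
  leading z q P -> leading z' q' P' ->
  (forall c c', P c -> P' c' -> Q (mmul c.1 c'.1, mmul c.2 c'.2)) ->
  (forall c, P c -> Q (c.1, mmul c.2 q')) ->
  (forall c', P' c' -> Q (c'.1, mmul q c'.2)) ->
  leading (z * z') (mmul q q') Q.
Proof.
move=> [l -> lP] [l' -> lP'] PP PQ QP.
exists ([seq (mmul c.1 c'.1, mmul c.2 c'.2) | c <- l, c' <- l'] ++
  [seq (c.1, mmul c.2 q') | c <- l] ++ [seq (c.1, mmul q c.2) | c <- l']).
  set S := \sum_(c <- l) _; set S' := \sum_(c <- l') _.
  have E1 : S * S' = \sum_(c <- l) \sum_(c' <- l') of_pair R (mmul c.1 c'.1) (mmul c.2 c'.2).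
    rewrite mulr_suml; apply: eq_bigr => c _; rewrite mulr_sumr.
    by apply: eq_bigr => c' _; rewrite of_pairM.
  have E2 : S * of_pair R mone q' = \sum_(c <- l) of_pair R c.1 (mmul c.2 q').
    by rewrite mulr_suml; apply: eq_bigr => c _; rewrite of_pairM mulm1.
  have E3 : of_pair R mone q * S' = \sum_(c <- l') of_pair R c.1 (mmul q c.2).
    by rewrite mulr_sumr; apply: eq_bigr => c _; rewrite of_pairM mul1m.
  rewrite !big_cat /= big_allpairs_dep !big_map /= -E1 -E2 -E3 mulrDl !mulrDr of_pairM mul1m.
  move: (of_pair R mone _) (S * of_pair R mone q') (S * S') (_ * S') => x1 x2 x3 x4.
  by rewrite -addrA [_ + (x2 + _)]addrC [x2 + _]addrC -addrA.
move=> c; rewrite !mem_cat => /or3P[/allpairsP[[x y] [/= xl yl ->]]|/mapP[x xl ->]|/mapP[x xl ->]].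
- exact: PP (lP _ xl) (lP' _ yl).
- exact: PQ (lP _ xl).
- exact: QP (lP' _ xl).
Qed.

Lemma of_pair1 : of_pair R mone mone = 1 :> H2.
Proof. exact: mbasis1. Qed.

Lemma leading1 P : leading 1 mone P.
Proof. by exists [::]; rewrite // big_nil addr0 of_pair1. Qed.

(** [c.1] gathers the pruned trees and [c.2] what is left at the roots. Here [c.2] may be empty; in
    [tree_cut] it is a tree, the total cut being set apart. *)
Definition forest_cut s (c : pair) :=
  [/\ (0 < fsize c.1)%N, (fsize c.1 + fsize c.2 = sumn (map (@psize d) s))%N,
      (forall rho, rho \in forest_seq c.1 ->
         exists t, t \in s /\ contains (\pi t) rho) &
      exists2 v, c.2 = seq_forest [seq \pi t | t <- v] &
        v \in choices [seq rsubtrees t | t <- s]].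

Definition tree_cut t (c : pair) :=
  [/\ (0 < fsize c.1)%N, (fsize c.1 + fsize c.2 = psize t)%N,
      (forall rho, rho \in forest_seq c.1 -> contains (\pi t) rho) &
      exists2 a, c.2 = ucm (\pi a) & a \in rsubtrees t].

Lemma seq_forest_cat (s1 s2 : seq (tree d)) :
  seq_forest (s1 ++ s2) = mmul (seq_forest s1) (seq_forest s2).
Proof. by rewrite /seq_forest big_cat. Qed.

Lemma choices_cons (T : Type) (l : seq T) ls :
  choices (l :: ls) = choices ls ++ [seq x :: w | x <- l, w <- choices ls].
Proof. by []. Qed.

Lemma choices_self s : s \in choices [seq rsubtrees t | t <- s].
Proof.
elim: s => [|t s IH]; first exact: mem_head.
rewrite /= mem_cat; apply/orP; right; apply/allpairsP; exists (t, s).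
by split=> //=; exact: rsubtrees_refl.
Qed.

Lemma fsize_seq_forest s : fsize (seq_forest [seq \pi t | t <- s]) = sumn (map (@psize d) s).
Proof.
rewrite /fsize (perm_sumn (perm_map _ (perm_forest_seq _))) -map_comp.
by congr sumn; apply: eq_map => t /=; rewrite tsize_pi.
Qed.

Lemma forest_cutM s1 s2 z1 z2 :
  leading z1 (seq_forest [seq \pi t | t <- s1]) (forest_cut s1) ->
  leading z2 (seq_forest [seq \pi t | t <- s2]) (forest_cut s2) ->
  leading (z1 * z2) (seq_forest [seq \pi t | t <- s1 ++ s2]) (forest_cut (s1 ++ s2)).
Proof.
move=> z1P z2P; rewrite map_cat seq_forest_cat; apply: leadingM z1P z2P _ _ _.
- move=> c c' [c0 cs cP [v cv vs]] [c0' cs' cP' [v' cv' vs']]; split=> /=.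
  + by rewrite fsizeM addn_gt0 c0.
  + by rewrite !fsizeM map_cat sumn_cat -cs -cs' addnACA.
  + move=> rho; rewrite (perm_mem (forest_seqM _ _)) mem_cat => /orP[/cP|/cP'] [t [ts tr]];
    by exists t; rewrite mem_cat ts ?orbT.
  + exists (v ++ v'); first by rewrite cv cv' map_cat seq_forest_cat.
    by rewrite map_cat; apply/choices_catP; exists v, v'.
- move=> c [c0 cs cP [v cv vs]]; split=> //=.
  + by rewrite fsizeM map_cat sumn_cat -cs fsize_seq_forest addnA.
  + by move=> rho /cP[t [ts tr]]; exists t; rewrite mem_cat ts.
  + exists (v ++ s2); first by rewrite cv map_cat seq_forest_cat.
    by rewrite map_cat; apply/choices_catP; exists v, s2; rewrite choices_self.
- move=> c [c0 cs cP [v cv vs]]; split=> //=.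
  + by rewrite fsizeM map_cat sumn_cat -cs fsize_seq_forest addnCA.
  + by move=> rho /cP[t [ts tr]]; exists t; rewrite mem_cat ts orbT.
  + exists (s1 ++ v); first by rewrite cv map_cat seq_forest_cat.
    by rewrite map_cat; apply/choices_catP; exists s1, v; rewrite choices_self.
Qed.

(** The coproducts of the branches multiply to the cuts of the forest of branches, and grafting the
    remainders turns these into cuts of the tree. *)
Lemma ptree_coproduct_leading t : exists2 z,
  ptree_coproduct R t = of_pair R (ucm (\pi t)) mone + z &
  leading z (ucm (\pi t)) (tree_cut t).
Proof.
elim/ptree_ind_mem: t => i s IH /=; eexists; first by [].
have : leading (\prod_(u <- s) ptree_coproduct R u)
    (seq_forest [seq \pi t | t <- s]) (forest_cut s).
  elim: s IH => [|t s IHs] IH.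
    by rewrite big_nil /seq_forest big_nil; apply: leading1.
  rewrite big_cons -cat1s; apply: forest_cutM; last first.
    by apply: IHs => u us; apply: IH; rewrite inE us orbT.
  have [z -> [l -> lP]] := IH t (mem_head _ _).
  (* Pruning a whole branch is the total cut of the branch, but only a proper cut of the tree above
     it. *)
  exists ((ucm (\pi t), mone) :: l).
    by rewrite big_cons /= addrCA /seq_forest big_seq1.
  move=> c; rewrite inE => /predU1P[->|/lP[c0 cs cP [a ca ta]]]; split=> //.
  - by rewrite /= fsizeU tsize_gt0.
  - by rewrite /= fsizeU tsize_pi addn0 /fsize forest_seq1 addn0.
  - move=> rho; rewrite forest_seqU inE => /eqP ->; exists t; rewrite mem_head; split=> //.
    by apply/containsP; exists t; rewrite ?subtrees_refl.
  - by exists [::]; [rewrite /seq_forest big_nil | exact: mem_head].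
  - by rewrite /= addn0.
  - by move=> rho /cP; exists t; rewrite mem_head.
  - exists [:: a]; first by rewrite ca /seq_forest big_seq1.
    rewrite map_cons choices_cons mem_cat; apply/orP; right.
    by apply/allpairsP; exists (a, [::]); rewrite /= mem_head.
rewrite big_map => -[l -> lP].
exists [seq (c.1, ucm (graft i c.2)) | c <- l].
  rewrite raddfD raddf_sum /= big_map /= /id_graft !linextU /= graftE; congr (_ + _).
  by apply: eq_bigr => c _; rewrite linextU.
move=> c /mapP[x /lP[c0 cs cP [v cv vs]] ->]; split=> //=.
- by rewrite fsizeU tsize_graft addnS cs.
- move=> rho /cP[t [ts /containsP[a -> at_]]]; apply/containsP; exists a => //.
  by rewrite subtreesE mem_cat; apply/orP; right; apply/flatten_mapP; exists t.
- by exists (PNode i v); [rewrite cv graftE | apply: map_f].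
Qed.

(** The sizes allow inductions on the number of nodes; containment confines the effect of a
    coordinate at [tau] to the trees containing [tau]. *)
Lemma coproduct_tree tau : exists2 l : seq pair,
  coproduct (of_tree R tau) =
    of_pair R (ucm tau) mone + of_pair R mone (ucm tau) +
    \sum_(c <- l) of_pair R c.1 c.2 &
  forall c, c \in l -> [/\ (0 < fsize c.1)%N, (0 < fsize c.2)%N,
    (fsize c.1 + fsize c.2 = tsize tau)%N &
    forall rho, rho \in forest_seq c.1 ++ forest_seq c.2 -> contains tau rho].
Proof.
rewrite /of_tree coproduct_forest forest_coproductU.
have [z -> [l -> lP]] := ptree_coproduct_leading (repr tau).
rewrite reprK in lP *; exists l; first by rewrite addrA.
move=> c /lP[c0 cs cP [a ca at_]]; split=> //.
- by rewrite ca fsizeU tsize_gt0.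
- rewrite -[tau]reprK => rho; rewrite mem_cat => /orP[/cP//|].
  rewrite ca forest_seqU inE => /eqP ->; apply/containsP; exists a => //.
  exact: subtrees_rsubtrees.
Qed.

End CoproductShape.

(** * Linear maps and algebra morphisms determined by forests or trees *)

Section Extensionality.
Variable R : comNzRingType.

Lemma linear_mbasis_ext (K : choiceType) (M : lmodType R) (F G : {linear {malg R[K]} -> M}) :
  (forall k, F (mbasis k) = G (mbasis k)) -> F =1 G.
Proof.
move=> FG x; rewrite (malg_sumE x) !raddf_sum /=; apply: eq_bigr => k _.
by rewrite !linearZ FG.
Qed.

Lemma hopf_ext_forest d (A : comAlgType R) (F G : {linear hopf R d -> A}) (f : forest d) :
  monoid_morphism F -> monoid_morphism G ->
  {in forest_seq f, forall tau, F (of_tree R tau) = G (of_tree R tau)} ->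
  F (of_forest R f) = G (of_forest R f).
Proof.
move=> [F1 FM] [G1 GM]; rewrite -[in of_forest R f](forest_seqK f) of_forest_seq.
elim: (forest_seq f) => [|tau s IH] FG; first by rewrite !big_nil F1 G1.
by rewrite !big_cons FM GM IH ?FG ?mem_head // => u us; rewrite FG // inE us orbT.
Qed.

Lemma hopf_ext d (A : comAlgType R) (F G : {linear hopf R d -> A}) :
  monoid_morphism F -> monoid_morphism G ->
  (forall tau, F (of_tree R tau) = G (of_tree R tau)) -> F =1 G.
Proof.
move=> FM GM FG; apply: linear_mbasis_ext => f.
by apply: hopf_ext_forest => // tau _.
Qed.

End Extensionality.

(** * The product of characters: associativity, and its terms on smaller trees *)

Section Star.
Variables (R : realType) (d : nat).
Local Notation H := (hopf R d).
Local Notation H2 := (hopf2 R d).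
Implicit Types (X Y Z : character R d) (tau rho sigma : tree d).

Lemma character_forest X (s : seq (tree d)) :
  X (of_forest R (seq_forest s)) = \prod_(tau <- s) X (of_tree R tau).
Proof.
rewrite of_forest_seq; elim: s => [|tau s IH]; first by rewrite !big_nil character1.
by rewrite !big_cons characterM IH.
Qed.

Lemma character_ext_forest X Y (f : forest d) :
  (forall tau, tau \in forest_seq f -> X (of_tree R tau) = Y (of_tree R tau)) ->
  X (of_forest R f) = Y (of_forest R f).
Proof.
by move=> XY; rewrite -(forest_seqK f) !character_forest; apply: eq_big_seq.
Qed.

Lemma character_ext X Y :
  (forall tau, X (of_tree R tau) = Y (of_tree R tau)) -> X = Y.
Proof.
move=> XY; apply: character_inj => x; rewrite (malg_sumE x) !raddf_sum /=.
apply: eq_bigr => f _; rewrite !linearZ /=; congr (_ * _).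
by apply: character_ext_forest => tau _.
Qed.

Section CharacterOf.
Variable y : tree d -> R.

Definition char_form : H -> R^o :=
  linext (fun f : forest d => \prod_(tau <- forest_seq f) y tau : R^o).

HB.instance Definition _ := GRing.Linear.on char_form.

Fact char_form_multiplicative : monoid_morphism char_form.
Proof.
apply: linext_is_multiplicative; split=> [f g|]; last by rewrite forest_seq1 big_nil.
by rewrite (perm_big _ (forest_seqM f g)) big_cat.
Qed.

Definition char_fun (x : H) : R := char_form x.

Fact char_fun_is_linear : linear_for *%R char_fun.
Proof. by move=> a u v; rewrite /char_fun linearP. Qed.

HB.instance Definition _ := GRing.isLinear.Build R H R *%R char_fun char_fun_is_linear.

Fact char_fun_neq0 : exists x, char_fun x <> 0.
Proof. by exists 1; rewrite /char_fun char_form_multiplicative.1; apply/eqP/oner_neq0. Qed.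

(** The forests form the polynomial algebra on trees, so the values of a character on trees can be
    prescribed freely. *)
Definition char_of : character R d :=
  @Character R d (char_fun : {scalar H}) char_fun_neq0 char_form_multiplicative.2.

Lemma char_of_tree tau : char_of (of_tree R tau) = y tau.
Proof.
rewrite /= /char_fun /char_form /of_tree /of_forest linextU forest_seqU.
by rewrite big_seq1.
Qed.

End CharacterOf.

Definition contract_left X : H2 -> H :=
  linext (fun p : forest d * forest d => X (of_forest R p.1) *: of_forest R p.2).

HB.instance Definition _ X := GRing.Linear.on (contract_left X).

Fact contract_left_multiplicative X : monoid_morphism (contract_left X).
Proof.
apply: linext_is_multiplicative; split=> [p q|] /=.
  rewrite /of_forest !mbasisM characterM.
  by rewrite -scalerAl -scalerAr scalerA.
by rewrite /of_forest !mbasis1 character1 scale1r.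
Qed.

(** The coproduct followed by [X] on the left factor. Composing these endomorphisms expresses
    coassociativity without a triple tensor product. *)
Definition coaction X (x : H) : H := contract_left X (coproduct x).

Fact coaction_is_linear X : linear (coaction X).
Proof. by move=> a x y; rewrite /coaction !linearP. Qed.

HB.instance Definition _ X := GRing.isLinear.Build R H H *:%R (coaction X) (coaction_is_linear X).

Fact coaction_multiplicative X : monoid_morphism (coaction X).
Proof.
split=> [|x y]; rewrite /coaction ?rmorph1 ?rmorphM.
  exact: (contract_left_multiplicative X).1.
exact: (contract_left_multiplicative X).2.
Qed.

Lemma star_coaction X Y x : star X Y x = Y (coaction X x).
Proof.
rewrite /= /star_fun /coaction; move: (coproduct x) => z; rewrite (malg_sumE z).
rewrite (linear_sum (contract_left X)) (linear_sum (tensor_form X Y)) (linear_sum Y).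
apply: eq_bigr => p _; rewrite !linearZ /= /tensor_form /contract_left !linextU linearZ /=.
by rewrite [in RHS]linearZ; exact: mulrCA.
Qed.

Definition graft_form i : H -> H :=
  linext (fun f : forest d => of_tree R (graft i f)).

HB.instance Definition _ i := GRing.Linear.on (graft_form i).

Lemma contract_left_id_graft X i z :
  contract_left X (id_graft i z) = graft_form i (contract_left X z).
Proof.
move: z; apply: (@linear_mbasis_ext _ _ _ (contract_left X \o id_graft i)
  (graft_form i \o contract_left X)) => p /=.
rewrite [id_graft i _]linextU [contract_left X (mbasis p)]linextU (linearZZ (graft_form i)).
rewrite [contract_left X _]linextU; congr (_ *: _); exact/esym/linextU.
Qed.

Lemma coaction_graft X i (f : forest d) :
  coaction X (of_tree R (graft i f)) =
  X (of_tree R (graft i f)) *: 1 + graft_form i (coaction X (of_forest R f)).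
Proof.
rewrite /coaction coproduct_graft linearD /= contract_left_id_graft; congr (_ + _).
by rewrite /contract_left linextU /= /of_forest mbasis1.
Qed.

(** Both sides are algebra morphisms, so it suffices to compare them on trees, by induction on
    grafting. *)
Lemma coaction_star X Y x : coaction (star X Y) x = coaction Y (coaction X x).
Proof.
have YXlin : linear (coaction Y \o coaction X) by move=> a u v /=; rewrite !linearP.
pose G : {linear H -> H} := HB.pack (coaction Y \o coaction X)
  (GRing.isLinear.Build R H H *:%R (coaction Y \o coaction X) YXlin).
have GM : monoid_morphism G.
  split=> [|u v] /=; first by rewrite !(coaction_multiplicative _).1.
  by rewrite !(coaction_multiplicative _).2.
apply: (@hopf_ext R d H (coaction (star X Y)) G (coaction_multiplicative _) GM) => {x} tau.
elim/tree_ind_graft: tau => i f IH.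
have {}IH := hopf_ext_forest (coaction_multiplicative (star X Y)) GM IH.
rewrite /= coaction_graft IH star_coaction coaction_graft !linearD /= !linearZ /=.
rewrite character1 (coaction_multiplicative Y).1 mulr1 scalerDl -!addrA; congr (_ + _).
have affineD (a b c e : H) r r' :
    a = r *: 1 + c -> b = r' *: 1 + e -> a + b = (r + r') *: 1 + (c + e).
  by move=> -> ->; rewrite scalerDl addrACA.
have affineZ k (a c : H) r : a = r *: 1 + c -> k *: a = (k * r) *: 1 + k *: c.
  by move=> ->; rewrite scalerDr scalerA.
(* The grafting formula, known for forests, extends by linearity to every [z], in particular to
   [coaction X (of_forest R f)]. *)
have E z : coaction Y (graft_form i z) =
    Y (graft_form i z) *: 1 + graft_form i (coaction Y z).
  rewrite (malg_sumE z); elim/big_ind: _ => [|u v Eu Ev|g _].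
  - by rewrite !linear0 scale0r addr0.
  - have GD x y : graft_form i (x + y) = graft_form i x + graft_form i y by exact: linearD.
    have CD x y : coaction Y (x + y) = coaction Y x + coaction Y y by exact: linearD.
    have YD x y : Y (x + y) = Y x + Y y by exact: linearD.
    rewrite (GD u v) (CD u v) (CD (graft_form i u) (graft_form i v)).
    rewrite (GD (coaction Y u) (coaction Y v)) (YD (graft_form i u) (graft_form i v)).
    exact: affineD Eu Ev.
  move: (z@_g) => c; have : coaction Y (graft_form i (mbasis g)) =
      Y (graft_form i (mbasis g)) *: 1 + graft_form i (coaction Y (mbasis g)).
    by rewrite {1 2}/graft_form !linextU coaction_graft.
  move: (mbasis g) => x Ex.
  have GZ y : graft_form i (c *: y) = c *: graft_form i y by exact: linearZZ.
  have CZ y : coaction Y (c *: y) = c *: coaction Y y by exact: linearZZ.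
  have YZ y : Y (c *: y) = c * Y y by exact: linearZ.
  apply: etrans (congr1 (coaction Y) (GZ x)) _; apply: etrans (CZ (graft_form i x)) _.
  apply: etrans (affineZ c _ _ _ Ex) _; apply: esym.
  exact: (congr2 (fun r (z' : H) => r *: 1 + z') (etrans (congr1 Y (GZ x)) (YZ _))
    (etrans (congr1 (graft_form i) (CZ x)) (GZ _))).
by rewrite E.
Qed.

Lemma starA X Y Z : star (star X Y) Z = star X (star Y Z).
Proof.
by apply: character_inj => x; rewrite !star_coaction coaction_star.
Qed.

(* The part of [star X Y] that only involves the proper subtrees of [tau]. *)
Definition star_defect X Y tau : R :=
  star X Y (of_tree R tau) - X (of_tree R tau) - Y (of_tree R tau).

Lemma star_tree X Y tau :
  star X Y (of_tree R tau) = X (of_tree R tau) + Y (of_tree R tau) + star_defect X Y tau.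
Proof. by rewrite /star_defect; ring. Qed.

(** The list comes before [X] and [Y], so that one expansion serves all pairs of times. *)
Lemma star_defectE tau : exists2 l : seq (forest d * forest d),
  forall X Y, star_defect X Y tau =
    \sum_(c <- l) X (of_forest R c.1) * Y (of_forest R c.2) &
  forall c, c \in l -> [/\ (0 < fsize c.1)%N, (0 < fsize c.2)%N,
    (fsize c.1 + fsize c.2 = tsize tau)%N &
    forall rho, rho \in forest_seq c.1 ++ forest_seq c.2 -> contains tau rho].
Proof.
have [l lE lP] := coproduct_tree R tau; exists l => // X Y.
rewrite /star_defect /= /star_fun lE !linearD raddf_sum /= /tensor_form !linextU /=.
rewrite /of_forest mbasis1 !character1 mulr1 mul1r -/(of_forest R _) -/(of_tree R tau).
rewrite -addrA -opprD addrAC subrr add0r.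
by apply: eq_bigr => c _; rewrite linextU.
Qed.

Lemma star_defect_ext X X' Y Y' tau :
  (forall rho, (tsize rho < tsize tau)%N -> contains tau rho ->
     X (of_tree R rho) = X' (of_tree R rho)) ->
  (forall rho, (tsize rho < tsize tau)%N -> contains tau rho ->
     Y (of_tree R rho) = Y' (of_tree R rho)) ->
  star_defect X Y tau = star_defect X' Y' tau.
Proof.
move=> XX YY; have [l lE lP] := star_defectE tau; rewrite !lE.
apply: eq_big_seq => c /lP[c1 c2 cs cP]; congr (_ * _).
- apply: character_ext_forest => rho rc; apply: XX.
    by rewrite -cs (leq_ltn_trans (tsize_fsize rc)) // -{1}[fsize c.1]addn0 ltn_add2l.
  by apply: cP; rewrite mem_cat rc.
- apply: character_ext_forest => rho rc; apply: YY.
    by rewrite -cs (leq_ltn_trans (tsize_fsize rc)) // -{1}[fsize c.2]add0n ltn_add2r.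
  by apply: cP; rewrite mem_cat rc orbT.
Qed.

End Star.

(** * Coordinates of branched rough paths in the group of Hölder families *)

Section Coordinates.
Variables (R : realType) (d : nat) (gamma : R).
Hypotheses (gamma_in01 : 0 < gamma < 1) (gammaV_notin_nat : gamma^-1 \isn't a Num.nat).
Local Notation I := (unit_interval R).
Local Notation i0 := (unit_interval0 R).
Local Notation N := (holder_depth gamma).
Local Notation family := (holder_family d gamma).
Local Notation brp := (branched_rough_path d gamma).
Implicit Types (tau rho sigma : tree d) (X Y : I -> I -> character R d) (g h : family)
  (s t u v : I).

Definition tree_exponent tau : R := gamma * (tsize tau)%:R.

Let gamma_gt0 : 0 < gamma. Proof. by case/andP: gamma_in01. Qed.

Lemma tree_exponent_gt0 tau : 0 < tree_exponent tau.
Proof. by rewrite mulr_gt0 // ltr0n tsize_gt0. Qed.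

(** An exponent equal to 1 would make [gamma^-1] the integer [tsize tau]. *)
Lemma tree_exponent_neq1 tau : tree_exponent tau != 1.
Proof.
apply: contra gammaV_notin_nat => /eqP E.
suff -> : gamma^-1 = (tsize tau)%:R by exact: natr_nat.
by apply: (@mulfI _ gamma); rewrite ?gt_eqF // mulfV ?gt_eqF // -E.
Qed.

Lemma tree_exponent_gt1 tau : (N < tsize tau)%N -> 1 < tree_exponent tau.
Proof.
move=> Nt; rewrite lt_neqAle eq_sym tree_exponent_neq1 /=.
have gV : 0 <= gamma^-1 by rewrite invr_ge0 ltW.
have /andP[_ lt] := truncn_itv gV; rewrite /tree_exponent -ler_pdivrMl // mulr1.
by rewrite (le_trans (ltW lt)) // ler_nat.
Qed.

Lemma powRD_ge0 (x r r' : R) : 0 <= r -> 0 <= r' -> x `^ (r + r') = x `^ r * x `^ r'.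
Proof.
move=> r0 r0'; have [/eqP|rr] := eqVneq (r + r') 0; last by rewrite powRD // (negPf rr).
by rewrite paddr_eq0 // => /andP[/eqP -> /eqP ->]; rewrite addr0 powRr0 mulr1.
Qed.

Lemma forest_bound X (f : forest d) :
  (forall tau, tau \in forest_seq f -> exists C, forall s t,
     `|X s t (of_tree R tau)| <= C * `|val t - val s| `^ tree_exponent tau) ->
  exists2 C, 0 <= C & forall s t,
    `|X s t (of_forest R f)| <= C * `|val t - val s| `^ (gamma * (fsize f)%:R).
Proof.
rewrite -[in of_forest R f](forest_seqK f) /fsize.
elim: (forest_seq f) => [|tau l IH] H.
  exists 1 => // s t; rewrite character_forest big_nil normr1 /= mulr0 powRr0 mulr1.
  exact: lexx.
have [C CP] := H tau (mem_head _ _).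
have [|D D0 DP] := IH; first by move=> rho rl; apply: H; rewrite inE rl orbT.
exists (`|C| * D) => [|s t]; first by rewrite mulr_ge0.
rewrite character_forest big_cons -character_forest normrM /= natrD mulrDr.
have g0 := ltW gamma_gt0; rewrite powRD_ge0 ?mulr_ge0 // mulrACA ler_pM //.
by rewrite (le_trans (CP s t)) // ler_wpM2r ?powR_ge0 // ler_norm.
Qed.

Lemma holder_bounded3_sum (T : eqType) (l : seq T) (F : T -> I -> I -> I -> R) (a : R) :
  (forall c, c \in l -> holder_bounded3 a (F c)) ->
  holder_bounded3 a (fun s u t => \sum_(c <- l) F c s u t).
Proof.
elim: l => [|c l IH] H; first by exists 0 => s u t; rewrite big_nil normr0 mul0r.
have [C CP] := H c (mem_head _ _).
have [|D DP] := IH; first by move=> e el; apply: H; rewrite inE el orbT.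
exists (C + D) => s u t; rewrite big_cons mulrDl.
by rewrite (le_trans (ler_normD _ _)) // lerD.
Qed.

Definition chen_defect X tau s u t : R := star_defect (X s u) (X u t) tau.

(** Chen's relation and the Hölder bound at [tau] together; over all trees they characterise
    branched rough paths, by [brp_tree_lift] and [tree_lift_brp]. *)
Definition tree_lift X tau :=
  holder_lift (tree_exponent tau) (chen_defect X tau) (fun s t => X s t (of_tree R tau)).

Section ChenDefect.
Variables (X : I -> I -> character R d) (tau : tree d).
Hypothesis XP : forall rho, (tsize rho < tsize tau)%N -> tree_lift X rho.

(** Associativity of [star], read at [tau]. The defects only see smaller trees, on which Chen's
    relation already holds. *)
Lemma chen_defect_cocycle : cocycle (chen_defect X tau).
Proof.
move=> s u t v; have E := congr1 (fun Z : character R d => Z (of_tree R tau))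
  (starA (X s u) (X u t) (X t v)).
move: E => /=; rewrite -!/(star _ _ _) !star_tree.
have starE x y z rho : (tsize rho < tsize tau)%N ->
    star (X x y) (X y z) (of_tree R rho) = X x z (of_tree R rho).
  by move=> rt; rewrite star_tree; have [/(_ x y z) -> _] := XP rt.
have -> : star_defect (star (X s u) (X u t)) (X t v) tau = chen_defect X tau s t v.
  by apply: star_defect_ext => // rho rt _; apply: starE.
have -> : star_defect (X s u) (star (X u t) (X t v)) tau = chen_defect X tau s u v.
  by apply: star_defect_ext => // rho rt _; apply: starE.
rewrite -/(chen_defect X tau s u t) -/(chen_defect X tau u t v).
by move: (X s u _) (X u t _) (X t v _) => x y z E; lra.
Qed.

(** Every term is a product of two bounded factors whose exponents add up to that of [tau]. *)
Lemma chen_defect_bounded : holder_bounded3 (tree_exponent tau) (chen_defect X tau).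
Proof.
have [l lE lP] := star_defectE R tau.
have [|K KP] := @holder_bounded3_sum _ l
  (fun c s u t => X s u (of_forest R c.1) * X u t (of_forest R c.2)) (tree_exponent tau).
  move=> c /lP[c1 c2 cs _].
  have bound f : (fsize f < tsize tau)%N -> exists2 C, 0 <= C & forall s t,
      `|X s t (of_forest R f)| <= C * `|val t - val s| `^ (gamma * (fsize f)%:R).
    move=> ft; apply: forest_bound => rho rf.
    by have [] := XP (leq_ltn_trans (tsize_fsize rf) ft).
  have [|C C0 CP] := bound c.1; first by rewrite -cs -{1}[fsize c.1]addn0 ltn_add2l.
  have [|D D0 DP] := bound c.2; first by rewrite -cs -{1}[fsize c.2]add0n ltn_add2r.
  exists (C * D) => s u t; rewrite normrM /tree_exponent -cs natrD mulrDr.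
  have g0 n : 0 <= gamma * n%:R by rewrite mulr_ge0 // ltW.
  rewrite powRD_ge0 // mulrACA ler_pM //.
    apply: le_trans (CP s u) _; rewrite ler_wpM2l // ger0_le_powR //.
    by rewrite lerDl.
  apply: le_trans (DP u t) _; rewrite ler_wpM2l // ger0_le_powR //.
  by rewrite lerDr.
by exists K => s u t; rewrite /chen_defect lE; apply: KP.
Qed.

Lemma base_lift_chen_defect : holder_lift (tree_exponent tau) (chen_defect X tau)
  (base_lift (tree_exponent tau) (chen_defect X tau)).
Proof.
apply: base_liftP; rewrite ?tree_exponent_gt0 ?tree_exponent_neq1 //.
  exact: chen_defect_cocycle.
exact: chen_defect_bounded.
Qed.

End ChenDefect.

Lemma brp_tree_lift (X : brp) tau : tree_lift X tau.
Proof.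
split=> [s u t|]; first by rewrite -(brp_chen X s u t) star_tree.
by have [C CP] := brp_regular X (ucm tau); rewrite fsizeU in CP; exists C.
Qed.

Lemma tree_lift_brp X : (forall tau, tree_lift X tau) ->
  exists Y : brp, forall s t, Y s t = X s t.
Proof.
move=> XP.
have chen s u t : star (X s u) (X u t) = X s t.
  apply: character_ext => tau; rewrite star_tree.
  by have [/(_ s u t) -> _] := XP tau.
have reg (f : forest d) : exists C, forall s t,
    `|X s t (of_forest R f)| <= C * `|val t - val s| `^ (gamma * (fsize f)%:R).
  by have [|C _ CP] := @forest_bound X f; [move=> tau _; case: (XP tau) | exists C].
by exists (BranchedRoughPath chen reg).
Qed.

Lemma holder_familyP h (tau : trees_upto d N) :
  holder (tree_exponent (val tau)) (h tau) /\ h tau i0 = 0.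
Proof. by have /asboolP := valP h; apply. Qed.

(** Zero beyond [N] nodes is the right default: there the exponent exceeds 1, lifts are unique and
    no coordinate is free. *)
Definition extend h tau t : R := if insub tau is Some tau' then h tau' t else 0.

Lemma extend_val h (tau : trees_upto d N) : extend h (val tau) = h tau.
Proof. by apply: funext => t; rewrite /extend valK. Qed.

Lemma extendD h g tau t : extend (h + g) tau t = extend h tau t + extend g tau t.
Proof. by rewrite /extend; case: insub => [tau'|]; rewrite ?holder_familyD ?addr0. Qed.

Lemma extend_holder h tau : holder (tree_exponent tau) (extend h tau).
Proof.
rewrite /extend; case: insubP => [tau' _ <-|_]; last exact: holder0.
by have [] := holder_familyP h tau'.
Qed.

(* [h] collects the coordinates of [X] with respect to the canonical lifts of
   its own Chen defects, which only depend on smaller trees. *)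
Definition has_coordinates X h := forall tau s t,
  X s t (of_tree R tau) = base_lift (tree_exponent tau) (chen_defect X tau) s t +
    extend h tau t - extend h tau s.

(** [P] is a class stable under passing to contained trees: all trees for uniqueness, the trees
    avoiding a given one for locality of the action. *)
Lemma has_coordinates_agree X Y h g (P : pred (tree d)) :
  has_coordinates X h -> has_coordinates Y g ->
  (forall sigma rho, contains sigma rho -> P sigma -> P rho) ->
  (forall tau, P tau -> extend h tau = extend g tau) ->
  forall tau, P tau -> forall s t, X s t (of_tree R tau) = Y s t (of_tree R tau).
Proof.
move=> Xh Yg Pc hg tau; have [n] := ubnP (tsize tau); elim: n tau => // n IH tau tn Ptau s t.
rewrite Xh Yg hg //; congr (base_lift _ _ _ _ + _ - _).
apply: funext => x; apply: funext => y; apply: funext => z.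
by apply: star_defect_ext => rho rt tr; apply: IH; rewrite ?(Pc _ _ tr) // (leq_trans rt).
Qed.

Lemma has_coordinates_unique X Y h : has_coordinates X h -> has_coordinates Y h ->
  forall s t, X s t = Y s t.
Proof.
move=> Xh Yh s t; apply: character_ext => tau.
exact: (has_coordinates_agree (P := predT) Xh Yh).
Qed.

Lemma has_coordinates_lift X h : has_coordinates X h -> forall tau, tree_lift X tau.
Proof.
move=> Xh tau; have [n] := ubnP (tsize tau); elim: n tau => // n IH tau tn.
rewrite /tree_lift (_ : (fun s t => _) = fun s t =>
  base_lift (tree_exponent tau) (chen_defect X tau) s t + extend h tau t - extend h tau s).
  apply: holder_lift_shift; last exact: extend_holder.
  by apply: base_lift_chen_defect => rho rt; apply: IH; rewrite (leq_trans rt).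
by apply: funext => s; apply: funext => t; apply: Xh.
Qed.

Section Build.
Variable h : family.

(** [n] is fuel bounding the size of the trees. The final 0 does not affect trees with at most [n]
    nodes, as each step only consults smaller ones. *)
Fixpoint build n s t tau : R :=
  if n is n'.+1 then
    base_lift (tree_exponent tau)
      (chen_defect (fun s t => char_of (build n' s t)) tau) s t +
    extend h tau t - extend h tau s
  else 0.

Lemma build_stable n m tau s t : (tsize tau <= n)%N -> (tsize tau <= m)%N ->
  build n s t tau = build m s t tau.
Proof.
elim: n m tau s t => [|n IH] [|m] tau s t;
  do ?[by rewrite leqNgt tsize_gt0 | by move=> _; rewrite leqNgt tsize_gt0].
move=> tn tm /=; congr (base_lift _ _ _ _ + _ - _).
apply: funext => x; apply: funext => y; apply: funext => z.
by apply: star_defect_ext => rho rt _; rewrite !char_of_tree;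
  apply: IH; rewrite -ltnS (leq_trans rt).
Qed.

Definition built s t : character R d := char_of (fun tau => build (tsize tau) s t tau).

Lemma built_has_coordinates : has_coordinates built h.
Proof.
move=> tau s t; rewrite {1}/built char_of_tree.
case tE : (tsize tau) (tsize_gt0 tau) => [//|n] _ /=; congr (base_lift _ _ _ _ + _ - _).
apply: funext => x; apply: funext => y; apply: funext => z.
by apply: star_defect_ext => rho rt _; rewrite !char_of_tree;
  apply: build_stable; rewrite // -ltnS -tE.
Qed.

End Build.

Lemma brp_of_coordinates h : exists X : brp, has_coordinates X h.
Proof.
have [X XE] := tree_lift_brp (has_coordinates_lift (@built_has_coordinates h)).
exists X; have -> : (X : I -> I -> character R d) = built h.
  by apply: funext => s; apply: funext => t.
exact: built_has_coordinates.
Qed.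

Lemma coordinates_exist (X : brp) : exists h, has_coordinates X h.
Proof.
have XL tau : holder_lift (tree_exponent tau) (chen_defect X tau)
    (base_lift (tree_exponent tau) (chen_defect X tau)).
  by apply: base_lift_chen_defect => rho _; apply: brp_tree_lift.
(* Starting from time 0 gives the coordinates the required value 0 there. *)
pose f tau t : R := X i0 t (of_tree R tau) -
  base_lift (tree_exponent tau) (chen_defect X tau) i0 t.
have fP : (fun tau : trees_upto d N => f (val tau)) \in @holder_family_pred R d gamma.
  apply/asboolP => tau; have [H f0 _] := holder_lift_diff (brp_tree_lift X (val tau)) (XL (val tau)).
  by split.
exists (HolderFamily fP) => tau s t; rewrite /extend.
case: insubP => [tau' _ <-|]; last first.
  (* With more than [N] nodes, the path itself must be the base lift. *)
  rewrite -ltnNge subr0 addr0 => Nt.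
  exact: (holder_lift_unique (tree_exponent_gt1 Nt) (brp_tree_lift X tau) (XL tau)).
by have [_ _ ->] := holder_lift_diff (brp_tree_lift X (val tau')) (XL (val tau')).
Qed.

Lemma coordinates_unique X g h : has_coordinates X g -> has_coordinates X h -> g = h.
Proof.
move=> Xg Xh; apply: val_inj; apply: funext => tau; apply: funext => t /=.
have := Xg (val tau) i0 t; rewrite Xh !extend_val.
have [_ ->] := holder_familyP g tau; have [_ ->] := holder_familyP h tau.
by rewrite !subr0 => /addrI.
Qed.

End Coordinates.

(** * The action by translation of coordinates *)

Theorem theorem1p2 (R : realType) (d : nat) (gamma : R)
    (d_ge1 : (1 <= d)%N) (gamma_in01 : 0 < gamma < 1)
    (gammaV_notin_nat : gamma^-1 \isn't a Num.nat) :
  exists act : holder_family d gamma ->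
      branched_rough_path d gamma -> branched_rough_path d gamma,
  [/\ forall X, act 0 X = X,
      forall g g' X, act g' (act g X) = act (g + g') X,
      forall (g : holder_family d gamma) (tau : trees_upto d (holder_depth gamma)),
        unique (fun rho => exists t, g rho t <> 0) tau ->
        forall X : branched_rough_path d gamma,
        (forall s t, act g X s t (of_tree R (val tau)) =
           X s t (of_tree R (val tau)) + g tau t - g tau s) /\
        (forall sigma : tree d, ~~ contains sigma (val tau) ->
           forall s t, act g X s t (of_tree R sigma) = X s t (of_tree R sigma))
    & forall X X', exists! g, act g X = X'].
Proof.
have [coord coordP] := choice (coordinates_exist gamma_in01 gammaV_notin_nat (d := d)).
have [phi phiP] := choice (brp_of_coordinates gamma_in01 gammaV_notin_nat (d := d)).
have coordK X : phi (coord X) = X.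
  by apply: brp_inj; exact: has_coordinates_unique (phiP _) (coordP _).
have phiK h : coord (phi h) = h := coordinates_unique (coordP _) (phiP _).
exists (fun g X => phi (coord X + g)); split.
- by move=> X; rewrite addr0.
- by move=> g g' X; rewrite phiK addrA.
- move=> g tau [_ g_unique] X.
  have g_eq0 rho : rho != val tau -> extend (coord X + g) rho = extend (coord X) rho.
    move=> rho_tau; apply: funext => t; rewrite extendD /extend.
    case: insubP => [rho' _ rhoE|]; last by rewrite addr0.
    have [->|/eqP grho] := eqVneq (g rho' t) 0; first by rewrite addr0.
    by move: rho_tau; rewrite -rhoE (g_unique rho' (ex_intro _ t grho)) eqxx.
  have agree rho : ~~ contains rho (val tau) -> forall s t,
      phi (coord X + g) s t (of_tree R rho) = X s t (of_tree R rho).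
    apply: (has_coordinates_agree (P := fun rho => ~~ contains rho (val tau)) (phiP _) (coordP X)).
      by move=> sigma rho' sr; apply: contra; apply: contains_trans.
    (* A tree contains itself, so one that does not contain [tau] differs from [tau]. *)
    move=> rho' /negP rt; apply: g_eq0; apply/eqP => rE; apply: rt; rewrite rE.
    by elim/quotW: (val tau) => a; apply/containsP; exists a; rewrite ?subtrees_refl.
  split=> // s t; rewrite (phiP (coord X + g) (val tau) s t) (coordP X (val tau) s t).
  rewrite !extendD !extend_val.
  (* Trees smaller than [tau] cannot contain it, so both paths agree on them and have the same base
     lift at [tau]. *)
  have -> : chen_defect (phi (coord X + g)) (val tau) = chen_defect X (val tau).
    apply: funext => x; apply: funext => y; apply: funext => z.
    by apply: star_defect_ext => rho rt _; apply: agree;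
      apply: contraTN rt => /contains_tsize; rewrite -leqNgt.
  by ring.
- move=> X X'; exists (coord X' - coord X); split; first by rewrite addrC subrK coordK.
  by move=> g <-; rewrite phiK addrC addKr.
Qed.
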